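(* For every $n\ge1$, the labeling $\lambda_E$ is an EW-labeling of the poset of weighted partitions $\Pi_n^w$, and hence $Q_{\lambda_E}(\Pi_n^w)$ is a Whitney dual of $\Pi_n^w$.
   Context: Weighted partitions: a weighted partition of $[n]$ is a set partition $B_1/\cdots/B_t$ of $[n]$ with weights $v_i\in\{0,\dots,|B_i|-1\}$, written $B_1^{v_1}/\cdots/B_t^{v_t}$. $\Pi_n^w$ has cover relations $A_1^{w_1}/\cdots/A_s^{w_s}\lessdot B_1^{v_1}/\cdots/B_{s-1}^{v_{s-1}}$ iff the second partition is obtained from the first by merging two blocks $A_i,A_j$ into $B_k=A_i\cup A_j$ with $v_k-(w_i+w_j)\in\{0,1\}$, all other blocks and weights unchanged. For a cover where blocks $A^{w_A}$, $B^{w_B}$ with $\min A<\min B$ merge into $(A\cup B)^{w_A+w_B+u}$, $u\in\{0,1\}$, set $\lambda_E=(\min A,\min B)^u$. The label poset is $\Lambda_n=\Gamma_1\oplus\cdots\oplus\Gamma_n$ (ordinal sum), where $\Gamma_a=\{(a,b)^u: a<b\le n+1,\ u\in\{0,1\}\}$ ordered by $(a,b)^u\le(a,c)^v$ iff $b\le c$ and $u\le v$. E-labelings: words of labels read bottom to top; increasing = strictly increasing; ascent-free = no consecutive $a<b$. ER-labeling: every closed interval has exactly one increasing maximal chain. Rank two switching property: for every saturated chain $\hat0=x_0\lessdot\cdots\lessdot x_k$ and $i$ with $\lambda(x_{i-1}\lessdot x_i)<\lambda(x_i\lessdot x_{i+1})$ there is a unique $x_i'$ with $x_{i-1}\lessdot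 x_i'\lessdot x_{i+1}$, $\lambda(x_{i-1}\lessdot x_i')=\lambda(x_i\lessdot x_{i+1})$, $\lambda(x_i'\lessdot x_{i+1})=\lambda(x_{i-1}\lessdot x_i)$. EW-labeling: ER-labeling with the rank two switching property such that in each interval distinct maximal chains have distinct label words. $Q_\lambda(P)$: $C(P)$ is the set of saturated chains from $\hat0$ ordered by inclusion; $\mathbf c_1\sim_\lambda\mathbf c_2$ iff they end at the same $y$ and are connected by quadratic exchanges (replacing $x_i$ by $x_i'$ at an ascent, forwards or backwards) among maximal chains of $[\hat0,y]$; $Q_\lambda(P)$ is the set of classes ordered by the transitive closure of: $X\le Y$ if some $\mathbf c\in X$, $\mathbf d\in Y$ have $\mathbf c\subseteq\mathbf d$. Whitney numbers: $w_k(P)=\sum_{\rho(x)=k}\mu(\hat0,x)$, $W_k(P)=|\{x:\rho(x)=k\}|$; Whitney duals: $|w_k(P)|=W_k(Q)$, $|w_k(Q)|=W_k(P)$ for all $k$. *)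

(* Defs.v *)
From HB Require Import structures.
From mathcomp Require Import all_boot all_order ssralg ssrint.
Set Implicit Arguments. Unset Strict Implicit. Unset Printing Implicit Defensive.

Section FinPoset.
Variables (U : finType) (A : {set U}) (le : rel U).

Definition plt (x y : U) : bool := le x y && (x != y).

Definition pcover (x y : U) : bool :=
  [&& x \in A, y \in A, plt x y & ~~ [exists t in A, plt x t && plt t y]].

Definition is_poset : Prop :=
  [/\ {in A, forall x, le x x},
      {in A &, forall x y, le x y -> le y x -> x = y} &
      {in A & &, forall x y t, le x y -> le y t -> le x t}].

Definition is_bottom (z : U) : Prop := z \in A /\ {in A, forall x, le z x}.

Definition schain_len (z : U) (k : nat) (x : U) : bool :=
  [exists t : k.-tuple U, path pcover z t && (last z t == x)].

Definition ranked_from (z : U) : Prop :=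
  forall x k l, x \in A -> schain_len z k x -> schain_len z l x -> k = l.

Definition ranked_poset_bot (z : U) : Prop :=
  [/\ is_poset, is_bottom z & ranked_from z].

(* Moebius function mu(z, x), by the usual recursion
   mu(z,z) = 1, mu(z,x) = - sum_{z <= y < x} mu(z,y); fuel #|U| suffices *)
Fixpoint mob_rec (z : U) (f : nat) (x : U) : int :=
  match f with
  | 0 => 0%R
  | f'.+1 => if x == z then 1%R
             else (- \sum_(y in A | le z y && plt y x) mob_rec z f' y)%R
  end.

Definition mobius (z x : U) : int := mob_rec z #|U| x.

Definition whitney1 (z : U) (k : nat) : int :=
  (\sum_(x in A | schain_len z k x) mobius z x)%R.

Definition whitney2 (z : U) (k : nat) : nat :=
  #|[set x in A | schain_len z k x]|.

End FinPoset.

Definition whitney_dual (U V : finType) (A : {set U}) (le : rel U) (z : U)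
    (B : {set V}) (le' : rel V) (z' : V) : Prop :=
  [/\ ranked_poset_bot A le z, ranked_poset_bot B le' z' &
      forall k, absz (whitney1 A le z k) = whitney2 B le' z' k /\
                absz (whitney1 B le' z' k) = whitney2 A le z k].

Section Labeling.
Variables (U : finType) (A : {set U}) (le : rel U).
Variables (L : eqType) (llt : rel L) (lam : U -> U -> L).

Local Notation cov := (pcover A le).

Definition lword (x : U) (s : seq U) : seq L := pairmap lam x s.

Definition maxchain (x y : U) (s : seq U) : bool := path cov x s && (last x s == y).

Definition increasing (w : seq L) : bool := sorted llt w.

Definition ER_labeling : Prop :=
  forall x y, x \in A -> y \in A -> le x y ->
    exists! s : seq U, maxchain x y s && increasing (lword x s).

Definition rank2_switching (z : U) : Prop :=
  forall (s : seq U) (b c : U),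
    path cov z s -> cov (last z s) b -> cov b c ->
    llt (lam (last z s) b) (lam b c) ->
    exists! b' : U, [/\ cov (last z s) b', cov b' c,
                       lam (last z s) b' = lam b c & lam b' c = lam (last z s) b].

Definition distinct_words : Prop :=
  forall x y s t, maxchain x y s -> maxchain x y t -> lword x s = lword x t -> s = t.

Definition EW_labeling (z : U) : Prop :=
  [/\ ER_labeling, rank2_switching z & distinct_words].

Definition is_schain (z : U) (C : {set U}) : bool :=
  [exists t : (#|C|.-1).-tuple U, path cov z t && (C == z |: [set x | x \in (t : seq U)])].

Definition qstep (C D : {set U}) : bool :=
  [exists a in C, exists b in C, exists c in C, exists b' : U,
    [&& cov a b, cov b c, llt (lam a b) (lam b c), cov a b', cov b' c,
        lam a b' == lam b c, lam b' c == lam a b & D == b' |: (C :\ b)]].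

Definition qrel (z : U) (C D : {set U}) : bool :=
  [&& is_schain z C, is_schain z D & qstep C D || qstep D C].

Definition qclass (z : U) (C : {set U}) : {set {set U}} := [set D | connect (qrel z) C D].

Definition Q_carrier (z : U) : {set {set {set U}}} :=
  qclass z @: [set C | is_schain z C].

Definition Q_rel (z : U) (X Y : {set {set U}}) : bool :=
  [&& X \in Q_carrier z, Y \in Q_carrier z &
      [exists c in X, exists d in Y, c \subset d]].

Definition Q_le (z : U) : rel {set {set U}} := connect (Q_rel z).

Definition Q_bot (z : U) : {set {set U}} := qclass z [set z].

End Labeling.

(* Weighted partitions of [n] = {0,...,n-1} (element i stands for i+1).     *)
(* A weighted partition is a set of (block, weight) pairs.                   *)
Definition wpT (n : nat) : finType := {set ({set 'I_n} * 'I_n.+1)}%type.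

Definition is_wpart (n : nat) (x : wpT n) : bool :=
  [&& [forall p in x, (p.1 != set0) && (val p.2 < #|p.1|)],
      [forall p in x, forall q in x, (p == q) || [disjoint p.1 & q.1]] &
      [forall i : 'I_n, [exists p in x, i \in p.1]]].

Definition wpart_set (n : nat) : {set wpT n} := [set x | is_wpart x].

Definition wmerge (n : nat) (x y : wpT n) (pA pB : {set 'I_n} * 'I_n.+1) (u : bool)
  : bool :=
  [&& pA \in x, pB \in x, pA != pB &
      [exists w : 'I_n.+1, (val w == val pA.2 + val pB.2 + u) &&
         (y == (x :\ pA :\ pB) :|: [set (pA.1 :|: pB.1, w)])]].

Definition wcov (n : nat) (x y : wpT n) : bool :=
  [&& is_wpart x, is_wpart y &
      [exists pA, exists pB, exists u : bool, wmerge x y pA pB u]].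

Definition wle (n : nat) : rel (wpT n) := connect (@wcov n).

Definition wbot (n : nat) : wpT n := [set ([set i], ord0) | i : 'I_n].

Definition bmin (n : nat) (B : {set 'I_n}) : nat := \big[minn/n]_(i in B) val i.

(* labels (a,b)^u encoded as (a, b, u) *)
Definition label := (nat * nat * bool)%type.

(* lambda_E(x <. y) = (min A, min B)^u, elements shifted to 1..n *)
Definition lamE (n : nat) (x y : wpT n) : label :=
  match [pick q : ({set 'I_n} * 'I_n.+1) * ({set 'I_n} * 'I_n.+1) * bool |
          wmerge x y q.1.1 q.1.2 q.2 && (bmin q.1.1.1 < bmin q.1.2.1)] with
  | Some q => ((bmin q.1.1.1).+1, (bmin q.1.2.1).+1, q.2)
  | None => (0, 0, false)
  end.

(* order of Lambda_n = Gamma_1 (+) ... (+) Gamma_n (ordinal sum) *)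
Definition lab_le (l1 l2 : label) : bool :=
  let: (a, b, u) := l1 in let: (a', b', v) := l2 in
  (a < a') || [&& a == a', b <= b' & (u <= v)%N].

Definition lab_lt (l1 l2 : label) : bool := lab_le l1 l2 && (l1 != l2).

(* Main.v *)
(** A saturated chain of weighted partitions is determined by its start and by
    its word of labels. Two consecutive merges with ascending labels involve
    independent pairs of blocks, so they commute: this is rank two switching.
    Reading two consecutive merges that do not ascend, one can always replace
    them by an ascending pair with the same result and a lexicographically
    smaller first label, so every interval has an increasing chain; in an
    increasing chain a block that absorbs another one is never absorbed later,
    which makes the chain unique.

    Words modulo exchange of adjacent ascents have a unique ascent-free
    representative, since the relative order of incomparable labels is invariant
    under exchanges. Hence in the poset P every word has a unique increasing
    extension up to a given element, and in Q every class has a unique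
    ascent-free one. In either situation the Moebius function is, up to sign, the
    number of words of the opposite kind: the sum over y <= x telescopes to the
    alternating sum over the factorisations of a word into an ascent-free and an
    increasing part, which vanishes. This exchanges the two kinds of Whitney
    numbers. *)

Require Import Defs.
From mathcomp Require Import all_boot all_order ssralg ssrint.
From mathcomp Require Import zify.
Set Implicit Arguments. Unset Strict Implicit. Unset Printing Implicit Defensive.
Import GRing.Theory.

(** * Posets presented by words, and their Whitney numbers *)

Section WordModel.
Variables (U : finType) (A : {set U}) (le : rel U).
Variables (L : eqType) (Ws : seq (seq L)) (en : seq L -> U).

(** The weighted partitions and the exchange classes are both presented by one prefix-closed list of
    words, with different [en]; the abstract form lets one Moebius computation serve both. By
    [wm_size], word length is the rank. *)
Record word_model : Prop := WordModel {
  wm_uniq : uniq Ws;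
  wm_nil : [::] \in Ws;
  wm_carrier : forall x, x \in A <-> exists2 u, u \in Ws & en u = x;
  wm_prefix : forall u v, u ++ v \in Ws -> u \in Ws;
  wm_le : forall u x, u \in Ws -> x \in A ->
    (le (en u) x <-> exists2 v, u ++ v \in Ws & en (u ++ v) = x);
  wm_size : forall u w, u \in Ws -> w \in Ws -> en u = en w -> size u = size w }.

Hypothesis wm : word_model.
Let z := en [::].

Lemma wm_mem u : u \in Ws -> en u \in A.
Proof. by move=> uW; apply/(wm_carrier wm); exists u. Qed.

Lemma wm_le_cat u v : u ++ v \in Ws -> le (en u) (en (u ++ v)).
Proof.
move=> uvW; apply/(wm_le wm); [exact: (wm_prefix wm uvW)|exact: wm_mem|].
by exists v.
Qed.

Lemma wm_poset : is_poset A le.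
Proof.
split=> [x /(wm_carrier wm) [u uW <-]|x y xA yA|x y t xA yA tA].
- by have:= @wm_le_cat u [::]; rewrite cats0; apply.
- have /(wm_carrier wm) [u uW eux] := xA; rewrite -eux.
  move=> /(wm_le wm uW yA) [v uvW <-].
  have euA := wm_mem uW; move=> /(wm_le wm uvW euA) [v' uvvW e].
  have := wm_size wm uvvW uW e; rewrite !size_cat => s.
  have v0 : v = [::] by apply: size0nil; lia.
  by rewrite v0 cats0.
- have /(wm_carrier wm) [u uW eux] := xA; rewrite -eux.
  move=> /(wm_le wm uW yA) [v uvW <-] /(wm_le wm uvW tA) [v' uvvW e].
  by apply/(wm_le wm uW tA); exists (v ++ v'); rewrite catA.
Qed.

Lemma wm_bottom : is_bottom A le z.
Proof.
split=> [|x /(wm_carrier wm) [u uW <-]]; first exact/wm_mem/(wm_nil wm).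
by have := @wm_le_cat [::] u; apply.
Qed.

(** An element strictly between would split one letter into two nonempty extensions. *)
Lemma wm_cover_rcons u l : rcons u l \in Ws ->
  pcover A le (en u) (en (rcons u l)).
Proof.
move=> ulW; have uW : u \in Ws by apply: (wm_prefix wm (v := [:: l])); rewrite cats1.
apply/and4P; split; [exact: wm_mem|exact: wm_mem| |].
  rewrite /plt -{1}cats1 wm_le_cat ?cats1 //; apply/eqP => e.
  by have := wm_size wm uW ulW e; rewrite size_rcons; lia.
apply/existsP => -[t /andP[tA /andP[/andP[lut nut] /andP[ltu ntu]]]].
have [v uvW et] := (wm_le wm uW tA).1 lut.
have [v' uvvW e'] := (wm_le wm uvW (wm_mem ulW)).1 (eq_ind_r (le^~ _) ltu et).
have := wm_size wm uvvW ulW e'; rewrite !size_cat size_rcons => s.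
have [v0|v'0] : v = [::] \/ v' = [::].
- by case: v v' s {et e' uvW uvvW} => [|a v] [|b v'] /=; auto; lia.
- by move: nut; rewrite -et v0 cats0 eqxx.
- by move: ntu; rewrite -et -e' v'0 cats0 eqxx.
Qed.

Lemma wm_coverP x y : reflect
  (exists u l, [/\ rcons u l \in Ws, en u = x & en (rcons u l) = y])
  (pcover A le x y).
Proof.
apply: (iffP idP) => [/and4P[xA yA /andP[lxy nxy] /existsP nb]|]; last first.
  by move=> [u [l [ulW <- <-]]]; apply: wm_cover_rcons.
have /(wm_carrier wm) [u uW eux] := xA.
move: lxy; rewrite -eux => /(wm_le wm uW yA) [[|l v] ulvW ey].
  by case/eqP: nxy; rewrite -eux -ey cats0.
have E : u ++ l :: v = rcons u l ++ v by rewrite cat_rcons.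
rewrite E in ulvW ey.
have ulW := wm_prefix wm ulvW.
have /and4P[_ eulA pl _] := wm_cover_rcons ulW.
exists u, l; split=> //; apply/eqP/negPn/negP => nuly.
case: nb; exists (en (rcons u l)).
by rewrite eulA -{1}eux pl /plt nuly -ey wm_le_cat.
Qed.

Lemma wm_path u s : u \in Ws -> path (pcover A le) (en u) s ->
  exists2 w, w \in Ws & en w = last (en u) s /\ size w = size u + size s.
Proof.
elim: s u => [|y s IH] u uW /=; first by exists u => //; split=> //; rewrite addn0.
case/andP => cxy; have /wm_coverP [u' [l [ulW eu' ey]]] := cxy.
have /and4P[_ yA /andP[lxy _] _] := cxy.
have [v uvW ev] := (wm_le wm uW yA).1 lxy; rewrite -ev => p.
have [w wW [ew sw]] := IH _ uvW p; exists w => //; split=> //.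
have u'W : u' \in Ws by apply: (wm_prefix wm (v := [:: l])); rewrite cats1.
have := wm_size wm uvW ulW (etrans ev (esym ey)); rewrite size_rcons.
by have := wm_size wm u'W uW eu'; rewrite sw; lia.
Qed.

Lemma wm_schain_len u k : u \in Ws -> schain_len A le z k (en u) = (size u == k).
Proof.
move=> uW; apply/idP/idP.
  case/existsP => t /andP[p /eqP e].
  have [w wW [ew sw]] := wm_path (wm_nil wm) p.
  apply/eqP; rewrite (wm_size wm uW wW); last by rewrite ew e.
  by rewrite sw size_tuple.
suff [s p [es <-]] : exists2 s, path (pcover A le) z s &
    last z s = en u /\ size s = size u.
  by move/eqP => <-; apply/existsP; exists (in_tuple s); rewrite p es eqxx.
elim/last_ind: u uW => [|u l IH] ulW; first by exists [::].
have [|s p [es ss]] := IH.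
  by apply: (wm_prefix wm (v := [:: l])); rewrite cats1.
exists (rcons s (en (rcons u l))); last by rewrite last_rcons !size_rcons ss.
by rewrite rcons_path p es; apply: wm_cover_rcons.
Qed.

Lemma wm_ranked : ranked_poset_bot A le z.
Proof.
split; [exact: wm_poset|exact: wm_bottom|].
move=> x k l /(wm_carrier wm) [u uW <-].
by rewrite !wm_schain_len // => /eqP <- /eqP.
Qed.

(** The recursion determines the Moebius function; fuel suffices once it exceeds the number of
    elements strictly below [x], which drops along the recursion. *)
Lemma mob_recE (m : U -> int) : is_poset A le -> is_bottom A le z ->
  m z = 1%R ->
  {in A, forall x, x != z -> (\sum_(y in A | le y x) m y = 0)%R} ->
  forall f, {in A, forall x, #|[set y in A | plt le y x]| < f ->
  mob_rec A le z f x = m x}.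
Proof.
move=> [lexx lexy let_] [zA lez] mz ms; elim=> // f IH x xA lt_f /=.
case: eqVneq => [->//|xz].
have := ms x xA xz; rewrite (bigD1 x) ?xA ?lexx //= => /eqP.
rewrite addr_eq0 => /eqP ->; congr (- _)%R.
apply: eq_big => [y|y /and3P[yA _ yx]].
  by case yA: (y \in A); rewrite //= lez.
rewrite ltnS in lt_f; apply: IH => //; apply: leq_trans lt_f; apply: proper_card.
apply/properP; split; last first.
  by exists y; rewrite !inE yA //= /plt eqxx andbF.
apply/subsetP => t; rewrite !inE => /andP[tA /andP[ty tny]]; rewrite tA /=.
have /andP[lyx nyx] := yx.
rewrite /plt (let_ _ y) //=; apply: contraNneq nyx => tx.
by apply/eqP/lexy => //; rewrite -tx.
Qed.

Variables (r r' : rel L).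
Hypothesis r'E : forall a b, r' a b = ~~ r a b.

(** Peel off the first letter [b]: cut 0 contributes [path r' b w], and the other cuts contribute
    its negative when [r a b] holds, nothing otherwise. *)
Lemma alternating_path a (w : seq L) :
  (\sum_(0 <= i < (size w).+1 | path r a (take i w) && sorted r' (drop i w))
     (-1) ^+ i = (path r' a w)%:R :> int)%R.
Proof.
elim: w a => [|b w IH] a; first by rewrite big_mkcond big_nat1.
rewrite big_mkcond big_nat_recl //= r'E.
have -> : (\sum_(0 <= i < (size w).+1)
   (if r a b && path r b (take i w) && sorted r' (drop i w)
    then (-1) ^+ i.+1 else 0) = - ((r a b)%:R * (path r' b w)%:R) :> int)%R.
  rewrite -IH (big_mkcond (fun i => path r b _ && _)) /= mulr_sumr -sumrN.
  apply: eq_bigr => i _; case: (r a b); rewrite /= ?mul1r ?mul0r ?oppr0 //.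
  by case: ifP => _; rewrite ?oppr0 // exprS mulN1r.
by case: (r a b); case: (path r' b w); rewrite ?mul1r ?mul0r ?oppr0 ?subrr ?addr0.
Qed.

(** The pair of letters at a cut is unconstrained, so a word with any such cut has exactly two, just
    before and just after its turning letter, and their signs cancel. *)
Lemma alternating_sorted (w : seq L) : w != [::] ->
  (\sum_(0 <= i < (size w).+1 | sorted r (take i w) && sorted r' (drop i w))
     (-1) ^+ i = 0 :> int)%R.
Proof.
case: w => // a w _; rewrite big_mkcond big_nat_recl //=.
rewrite [X in (_ + X)%R](_ : _ = - (path r' a w)%:R)%R; last first.
  rewrite -alternating_path [in RHS]big_mkcond -sumrN.
  apply: eq_bigr => i _; case: ifP => _; rewrite ?oppr0 // exprS mulN1r //.
by case: (path r' a w); rewrite ?subrr ?oppr0 ?addr0.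
Qed.

Hypothesis unique_ext : forall u x, u \in Ws -> sorted r u -> x \in A ->
  le (en u) x ->
  exists! v, [/\ u ++ v \in Ws, en (u ++ v) = x & sorted r' v].

Let m x : int := (\sum_(u <- Ws | (en u == x) && sorted r u) (-1) ^+ size u)%R.

(** Shows that [m] satisfies the Moebius recursion, by summing over the factorisations of each word
    ending at [x]. *)
Lemma wm_sum0 x : x \in A -> x != z -> (\sum_(y in A | le y x) m y = 0)%R.
Proof.
move=> xA xz.
transitivity (\sum_(u <- Ws | sorted r u && le (en u) x) (-1) ^+ size u : int)%R.
  rewrite /m (exchange_big_dep (fun u => sorted r u && le (en u) x)) /=; last first.
    by move=> y u /andP[yA lyx] /andP[/eqP -> ->].
  rewrite big_seq_cond [RHS]big_seq_cond; apply: eq_bigr => u /and3P[uW su lux].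
  rewrite (big_pred1 (en u)) // => y /=; rewrite [en u == y]eq_sym su andbT.
  by case: eqVneq => [->|]; rewrite ?andbF // wm_mem // lux.
(* By [unique_ext], a word [u] with endpoint below [x] is a prefix of exactly one word ending at [x]
   with [r']-sorted remainder, so the inner sum has one term. *)
pose ok u w := prefix u w && sorted r' (drop (size u) w).
transitivity (\sum_(u <- Ws | sorted r u) \sum_(w <- Ws | (en w == x) && ok u w)
     (-1) ^+ size u : int)%R.
  rewrite [LHS]big_mkcondr /= big_seq_cond [RHS]big_seq_cond.
  apply: eq_bigr => u /andP[uW su]; case: ifP => [lux|nlux]; last first.
    rewrite big_seq_cond big1 // => w /and3P[wW /eqP ew /andP[/prefixP[v e] _]].
    by rewrite -ew e wm_le_cat // -e in nlux.
  have [v [[uvW ev sv] uv]] := unique_ext uW su xA lux.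
  rewrite -big_filter.
  suff -> : [seq w <- Ws | (en w == x) && ok u w] = [:: u ++ v] by rewrite big_seq1.
  rewrite -(filter_pred1_uniq (wm_uniq wm) uvW).
  apply: eq_in_filter => w wW; symmetry; apply/eqP/idP => [->|].
    by rewrite ev eqxx /ok prefix_prefix drop_size_cat.
  case/andP=> /eqP ew /andP[/prefixP[v' e]].
  rewrite e drop_size_cat // => sv'; rewrite (uv v') //.
  by split=> //; rewrite -e.
(* For fixed [w] the prefixes [u] correspond to the cuts of [w], and [w] is nonempty because [x] is
   not the bottom. *)
rewrite (exchange_big_dep (fun w => en w == x)) /=; last by move=> ? ? _ /andP[].
rewrite big_seq_cond big1 // => w /andP[wW /eqP ew].
have w0 : w != [::] by apply: contraNneq xz => w0; rewrite -ew w0.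
rewrite -[RHS](alternating_sorted w0).
pose takes := [seq take i w | i <- index_iota 0 (size w).+1].
transitivity (\sum_(u <- takes | sorted r u && sorted r' (drop (size u) w))
   (-1) ^+ size u : int)%R; last first.
  rewrite big_map big_seq_cond [RHS]big_seq_cond; apply: eq_big => [i|i].
    case: (boolP (i \in _)) => //=; rewrite mem_index_iota ltnS => /andP[_ iw].
    by rewrite size_takel.
  by rewrite mem_index_iota ltnS => /andP[/andP[_ iw] _]; rewrite size_takel.
rewrite -big_filter -[RHS]big_filter; apply: perm_big; apply: uniq_perm.
- exact/filter_uniq/(wm_uniq wm).
- apply: filter_uniq; rewrite map_inj_in_uniq ?iota_uniq // => i j.
  rewrite !mem_index_iota !ltnS => /andP[_ iw] /andP[_ jw] e.
  by rewrite -(size_takel iw) -(size_takel jw) e.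
move=> u; rewrite !mem_filter /ok ew eqxx /=.
have -> : (u \in takes) = prefix u w.
  apply/mapP/idP => [[i _ ->]|/prefixP[v e]]; first exact: prefix_take.
  exists (size u); last by rewrite e take_size_cat.
  by rewrite mem_index_iota ltnS e size_cat leq_addr.
case: (boolP (prefix u w)) => [/prefixP[v e]|]; rewrite ?andbF //= !andbT.
by rewrite (wm_prefix wm (v := v)) ?andbT // -e.
Qed.

Lemma wm_mobius x : x \in A -> mobius A le z x = m x.
Proof.
move=> xA; apply: mob_recE => //; [exact: wm_poset|exact: wm_bottom| |exact: wm_sum0|].
(* The empty word is the only one ending at the bottom. *)
- rewrite /m big_seq_cond (big_rem [::]) ?(wm_nil wm) //= eqxx /=.
  rewrite big_seq_cond big1 ?addr0 // => w /and3P[wr wW /andP[/eqP ew _]].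
  have := wm_size wm wW (wm_nil wm) ew => /size0nil w0.
  by move: wr; rewrite w0 mem_rem_uniq ?(wm_uniq wm) // inE eqxx.
- rewrite -cardsT; apply: proper_card; apply/properP; split; first exact: subsetT.
  by exists x => //; rewrite !inE /plt eqxx !andbF.
Qed.

(** All words ending in rank [k] have length [k], hence the same sign, and nothing cancels. *)
Lemma wm_whitney1 k :
  absz (whitney1 A le z k) = count (fun u => sorted r u && (size u == k)) Ws.
Proof.
have -> : whitney1 A le z k =
  (\sum_(u <- Ws | sorted r u && (size u == k)) (-1) ^+ k)%R.
  rewrite /whitney1; under eq_bigr => x /andP[xA _] do rewrite wm_mobius // /m.
  under eq_bigr do rewrite big_seq_cond.
  rewrite [RHS]big_seq_cond.
  rewrite (exchange_big_dep (fun u => (u \in Ws) && (sorted r u && (size u == k)))) /=.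
    apply: eq_bigr => u /and3P[uW su /eqP sk].
    rewrite (big_pred1 (en u)) ?sk // => x /=; rewrite uW su andbT /= eq_sym.
    by case: eqVneq => [->|]; rewrite ?andbF // wm_mem // wm_schain_len // sk eqxx.
  by move=> x u /andP[_ sx] /and3P[uW /eqP ex ->]; rewrite uW -(wm_schain_len _ uW) ex.
by rewrite big_const_seq iter_addr addr0 -mulr_natr abszM abszX exp1n mul1n natz.
Qed.

(** [unique_ext] at the empty prefix: each element ends exactly one [r']-sorted word. *)
Lemma wm_whitney2 k :
  whitney2 A le z k = count (fun u => sorted r' u && (size u == k)) Ws.
Proof.
set s := [seq u <- Ws | sorted r' u && (size u == k)].
have sorted_rep u x : u \in Ws -> en u = x -> sorted r' u ->
  exists2 v, v \in Ws & [/\ en v = x, sorted r' v & 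
     forall w, w \in Ws -> en w = x -> sorted r' w -> w = v].
  move=> uW ex su; have xA : x \in A by rewrite -ex wm_mem.
  have [//|v [[vW ev sv] uv]] := unique_ext (wm_nil wm) isT xA.
    by case: wm_bottom => _; apply.
  by exists v => //; split=> // w wW ew sw; rewrite (uv w).
have us : uniq [seq en u | u <- s].
  rewrite map_inj_in_uniq ?filter_uniq ?(wm_uniq wm) // => u w.
  rewrite !mem_filter => /andP[/andP[su _] uW] /andP[/andP[sw _] wW] e.
  have [v _ [_ _ uv]] := sorted_rep u _ uW erefl su.
  by rewrite (uv u) // (uv w).
rewrite -size_filter -/s -(size_map en) -(card_uniqP us); apply: eq_card => x.
rewrite inE; apply/andP/mapP => [[xA]|[u]].
  have [//|v [[vW ev sv] uv]] := unique_ext (wm_nil wm) isT xA.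
    by case: wm_bottom => _; apply.
  by rewrite -ev wm_schain_len // => sk; exists v => //; rewrite mem_filter sv sk.
rewrite mem_filter => /andP[/andP[su sk] uW ->].
by rewrite wm_mem // wm_schain_len.
Qed.

End WordModel.

(** * Weighted partitions as maps to block minima and weights *)

Section WeightedPartitions.
Variable n : nat.
Implicit Types (x y : wpT n) (i j : 'I_n).

(** The default never occurs on a weighted partition, whose blocks cover. *)
Definition block x i : {set 'I_n} * 'I_n.+1 :=
  odflt (set0, ord0) [pick p in x | i \in p.1].
(* A weighted partition is handled through the map [rep] sending an element to the
   minimum of its block and the map [wt] sending it to the weight of its block. *)
Definition rep x i : 'I_n := [arg min_(j < i in (block x i).1) val j].
Definition wt x i : nat := (block x i).2.

Lemma block_mem x i : is_wpart x -> block x i \in x /\ i \in (block x i).1.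
Proof.
case/and3P => _ _ /forallP/(_ i)/existsP[p ip]; rewrite /block.
by case: pickP => [q /andP[]|/(_ p)] //; rewrite ip.
Qed.

Lemma block_eq x i p : is_wpart x -> p \in x -> i \in p.1 -> block x i = p.
Proof.
move=> xw px ip; have [bx ib] := block_mem i xw.
have /and3P[_ /forallP/(_ _)/implyP/(_ bx)/forallP/(_ p)/implyP/(_ px) + _] := xw.
case/orP=> [/eqP//|/pred0P/(_ i) /=]; by rewrite ib ip.
Qed.

Lemma rep_mem x i : is_wpart x -> rep x i \in (block x i).1.
Proof. by move=> xw; have [_ ib] := block_mem i xw; rewrite /rep; case: arg_minnP. Qed.

Lemma rep_le_mem x i j : is_wpart x -> j \in (block x i).1 -> rep x i <= j.
Proof.
by move=> xw; have [_ ib] := block_mem i xw; rewrite /rep; case: arg_minnP => // k _;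
  apply.
Qed.

Lemma mem_block x i j : is_wpart x -> (j \in (block x i).1) = (rep x j == rep x i).
Proof.
move=> xw; have [bi ii] := block_mem i xw; have [bj jj] := block_mem j xw.
apply/idP/eqP => [ji|e].
  have e := block_eq xw bi ji; apply/val_inj/eqP; rewrite eqn_leq.
  by apply/andP; split; apply: rep_le_mem => //; [rewrite e|rewrite -e]; apply: rep_mem.
have <- : block x j = block x i => //.
have := rep_mem j xw => /(block_eq xw bj) <-; rewrite e.
exact/(block_eq xw bi)/rep_mem.
Qed.

Lemma eq_block x i j : is_wpart x -> (block x i == block x j) = (rep x i == rep x j).
Proof.
move=> xw; have [bi ii] := block_mem i xw; have [bj jj] := block_mem j xw.
apply/eqP/idP => [e|]; first by rewrite -mem_block // -e.
by rewrite -mem_block // => /(block_eq xw bj).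
Qed.

(** The conditions for a pair of maps to come from a weighted partition: the first two make [r] the
    minimum map of its fibres, the last two make [v] a legal weight on each fibre. *)
Record rep_ok (r : 'I_n -> 'I_n) (v : 'I_n -> nat) : Prop := RepOk {
  rep_idem : forall i, r (r i) = r i;
  rep_le : forall i, r i <= i;
  wt_rep : forall i, v (r i) = v i;
  wt_lt : forall i, v i < #|[set j | r j == r i]| }.

Lemma block1E x i : is_wpart x -> (block x i).1 = [set j | rep x j == rep x i].
Proof. by move=> xw; apply/setP => j; rewrite mem_block // inE. Qed.

Lemma rep_block x i : is_wpart x -> block x (rep x i) = block x i.
Proof.
by move=> xw; have [bi _] := block_mem i xw; exact/(block_eq xw bi)/rep_mem.
Qed.

Lemma wpart_rep_ok x : is_wpart x -> rep_ok (rep x) (wt x).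
Proof.
move=> xw; split=> i.
- by apply/eqP; rewrite -eq_block // rep_block.
- by rewrite rep_le_mem //; case: (block_mem i xw).
- by rewrite /wt rep_block.
- rewrite -block1E // /wt; have [bi _] := block_mem i xw.
  by have /and3P[/forallP/(_ (block x i))] := xw; rewrite bi /= => /andP[].
Qed.

Definition wpart_of (r : 'I_n -> 'I_n) (v : 'I_n -> nat) : wpT n :=
  [set ([set j | r j == r i], inord (v i)) | i : 'I_n].

Lemma wpart_of_rep x : is_wpart x -> wpart_of (rep x) (wt x) = x.
Proof.
move=> xw; apply/setP => p; apply/imsetP/idP => [[i _ ->]|px].
  by rewrite -block1E // inord_val -surjective_pairing; case: (block_mem i xw).
have /and3P[/forallP/(_ p)] := xw; rewrite px /= => /andP[/set0Pn[i ip] _] _ _.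
by exists i => //; rewrite -block1E // inord_val -surjective_pairing (block_eq xw px).
Qed.

Lemma eq_wpart_of r r' v v' : r =1 r' -> v =1 v' -> wpart_of r v = wpart_of r' v'.
Proof.
move=> er ev; apply: eq_imset => i; rewrite ev; congr (_, _).
by apply/setP => j; rewrite !inE !er.
Qed.

Lemma wpart_ext x y : is_wpart x -> is_wpart y ->
  rep x =1 rep y -> wt x =1 wt y -> x = y.
Proof. by move=> xw yw er ew; rewrite -(wpart_of_rep xw) -(wpart_of_rep yw);
  apply: eq_wpart_of. Qed.

Lemma wt_ltn r v i : rep_ok r v -> v i < n.+1.
Proof.
move=> ok; apply: leq_trans (wt_lt ok i) _.
by apply: leq_trans (max_card _) _; rewrite card_ord.
Qed.

Lemma wpart_of_wpart r v : rep_ok r v -> is_wpart (wpart_of r v).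
Proof.
move=> ok; apply/and3P; split.
- apply/forall_inP => p /imsetP[i _ ->] /=.
  rewrite inordK ?(wt_ltn i ok) // (wt_lt ok) andbT.
  by apply/set0Pn; exists i; rewrite inE.
- apply/forall_inP => p /imsetP[i _ ->]; apply/forall_inP => q /imsetP[j _ ->] /=.
  have [e|ne] := eqVneq (r i) (r j); [apply/orP; left|apply/orP; right].
    by rewrite e -(wt_rep ok i) e (wt_rep ok).
  apply/pred0P => k /=; rewrite !inE; apply/negP => /andP[/eqP -> /eqP e].
  by rewrite e eqxx in ne.
- apply/forallP => i; apply/existsP; exists ([set j | r j == r i], inord (v i)).
  by rewrite inE eqxx andbT; apply: imset_f.
Qed.

Lemma block_wpart_of r v i : rep_ok r v ->
  block (wpart_of r v) i = ([set j | r j == r i], inord (v i)).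
Proof.
by move=> ok; apply: block_eq; rewrite ?wpart_of_wpart ?imset_f // inE.
Qed.

Lemma rep_wpart_of r v : rep_ok r v -> rep (wpart_of r v) =1 r.
Proof.
move=> ok i; have xw := wpart_of_wpart ok; apply/val_inj/eqP; rewrite eqn_leq.
rewrite rep_le_mem ?block_wpart_of ?inE ?(rep_idem ok) //=.
have := rep_mem i xw; rewrite block_wpart_of // inE => /eqP <-.
exact: (rep_le ok).
Qed.

Lemma wt_wpart_of r v : rep_ok r v -> wt (wpart_of r v) =1 v.
Proof. by move=> ok i; rewrite /wt block_wpart_of // inordK // (wt_ltn _ ok). Qed.

Lemma bmin_eq (B : {set 'I_n}) i : i \in B -> {in B, forall j, i <= j} ->
  bmin B = i.
Proof.
move=> iB imin; rewrite /bmin; apply/eqP; rewrite eqn_leq; apply/andP; split.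
  elim: (index_enum _) (mem_index_enum i) => //= j s IH; rewrite inE big_cons.
  case/orP => [/eqP <-|/IH le_i]; first by rewrite iB geq_minl.
  by case: ifP => // _; rewrite geq_min le_i orbT.
elim/big_ind: _ => [|k l ik il|j]; [exact/ltnW/ltn_ord| |exact: imin].
by rewrite leq_min ik.
Qed.

Lemma bmin_block x i : is_wpart x -> bmin (block x i).1 = rep x i.
Proof. by move=> xw; apply: bmin_eq; [exact: rep_mem|move=> j; exact: rep_le_mem]. Qed.

(** * Letters and single merges *)

(** A letter [(a, b, u)] names the merge of the blocks with minima [a] and [b] that adds weight [u];
    it is the label before the shift to 1-based numbers. *)
Definition letter := ('I_n * 'I_n * bool)%type.
Implicit Types (l m : letter) (w : seq letter).

Definition mergeable x l := [&& rep x l.1.1 == l.1.1, rep x l.1.2 == l.1.2 &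
  l.1.1 < l.1.2].

Definition merge_at_rep x l i := if rep x i == l.1.2 then l.1.1 else rep x i.
Definition merge_at_wt x l i :=
  if (rep x i == l.1.1) || (rep x i == l.1.2) then wt x l.1.1 + wt x l.1.2 + l.2
  else wt x i.
Definition merge_at x l := wpart_of (merge_at_rep x l) (merge_at_wt x l).

Lemma merge_at_ok x l : is_wpart x -> mergeable x l ->
  rep_ok (merge_at_rep x l) (merge_at_wt x l).
Proof.
case: l => -[a b] u xw; rewrite /mergeable /merge_at_rep /merge_at_wt /= =>
  /and3P[/eqP ra /eqP rb ab].
have nab : (a == b) = false by apply/negbTE; rewrite neq_ltn ab.
have ok := wpart_rep_ok xw.
split=> i.
- case: (eqVneq (rep x i) b) => [_|nb]; first by rewrite ra nab.
  by rewrite (rep_idem ok) (negbTE nb).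
- case: (eqVneq (rep x i) b) => [e|nb]; last exact: (rep_le ok).
  by apply: ltnW (leq_trans ab _); rewrite -e (rep_le ok).
- case: (eqVneq (rep x i) b) => [_|nb]; first by rewrite ra eqxx orbT.
  by rewrite (rep_idem ok) (negbTE nb) (wt_rep ok).
case: ifP => [iab|/negbT]; last first.
  rewrite negb_or => /andP[na nb]; apply: leq_trans (wt_lt ok i) _.
  apply: subset_leq_card; apply/subsetP => j; rewrite !inE => /eqP ->.
  by rewrite (negbTE nb).
have la := wt_lt ok a; have lb := wt_lt ok b.
rewrite ra rb in la lb.
(* The new block is a disjoint union $A \cup B$; weights at most $|A|-1$ and $|B|-1$ leave room for
   the extra [u]. *)
suff -> : [set j | (if rep x j == b then a else rep x j) ==
     (if rep x i == b then a else rep x i)] =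
   [set j | rep x j == a] :|: [set j | rep x j == b].
  rewrite cardsU disjoint_setI0 ?cards0 ?subn0; first by case: (u); lia.
  apply/pred0P => j /=; rewrite !inE; apply/negP => /andP[/eqP -> /eqP].
  by move/eqP; rewrite nab.
apply/setP => j; rewrite !inE.
have -> : (if rep x i == b then a else rep x i) = a.
  by case: (eqVneq (rep x i) b) iab => // _; rewrite orbF => /eqP.
by case: (eqVneq (rep x j) b) => [_|]; rewrite ?eqxx ?orbT ?orbF.
Qed.

Lemma merge_at_wpart x l : is_wpart x -> mergeable x l -> is_wpart (merge_at x l).
Proof. by move=> xw /(merge_at_ok xw); exact: wpart_of_wpart. Qed.

Lemma rep_merge_at x l i : is_wpart x -> mergeable x l ->
  rep (merge_at x l) i = if rep x i == l.1.2 then l.1.1 else rep x i.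
Proof. by move=> xw fl; rewrite rep_wpart_of //; apply: merge_at_ok. Qed.

Lemma wt_merge_at x l i : is_wpart x -> mergeable x l ->
  wt (merge_at x l) i = if (rep x i == l.1.1) || (rep x i == l.1.2)
                   then wt x l.1.1 + wt x l.1.2 + l.2 else wt x i.
Proof. by move=> xw fl; rewrite wt_wpart_of //; apply: merge_at_ok. Qed.

(** The absorbed minimum is the only block minimum whose representative changes, which recovers both
    minima; the weight at the absorbing one then recovers the increment. *)
Lemma merge_at_inj x l m : is_wpart x -> mergeable x l -> mergeable x m ->
  merge_at x l = merge_at x m -> l = m.
Proof.
move=> xw fl fm e.
have er i : rep (merge_at x l) i = rep (merge_at x m) i by rewrite e.
have ew : wt (merge_at x l) l.1.1 = wt (merge_at x m) l.1.1 by rewrite e.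
move: er ew; rewrite !wt_merge_at // => er.
have := er l.1.2; rewrite !rep_merge_at //.
case: l m fl fm {e er} => -[a b] u [[c d] v].
move=> /and3P[/= /eqP ra /eqP rb ab] /and3P[/= /eqP rc /eqP rd cd].
rewrite rb eqxx; case: eqVneq => [<- <-|_ eab]; last by rewrite eab ltnn in ab.
by rewrite ra eqxx /=; case: u; case: v => //; lia.
Qed.

(** Ties the set-level definition of a merge to its description by minima and weights. *)
Lemma wmerge_merge_at x y a b u : is_wpart x -> mergeable x (a, b, u) ->
  wmerge x y (block x a) (block x b) u = (y == merge_at x (a, b, u)).
Proof.
move=> xw fl; have /and3P[/= /eqP ra /eqP rb ab] := fl.
have nab : (a == b) = false by apply/negbTE; rewrite neq_ltn ab.
have ok := merge_at_ok xw fl.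
rewrite /wmerge; have [-> _] := block_mem a xw; have [-> _] := block_mem b xw.
rewrite eq_block // ra rb nab /=.
pose p : {set 'I_n} * 'I_n.+1 :=
  ((block x a).1 :|: (block x b).1, inord (wt x a + wt x b + u)).
have wa : merge_at_wt x (a, b, u) a =
  wt x a + wt x b + u by rewrite /merge_at_wt /= ra eqxx.
have lw := wt_ltn a ok; rewrite wa in lw.
have -> : merge_at x (a, b, u) = (x :\ block x a :\ block x b) :|: [set p].
  apply/setP => q; rewrite !inE; apply/imsetP/idP => [[i _ ->]|].
    have [iab|] := boolP ((rep x i == a) || (rep x i == b)).
      apply/orP; right; apply/eqP; rewrite /p /merge_at_wt iab /=; congr (_, _).
      apply/setP => j; rewrite !inE !mem_block // ra rb /merge_at_rep /=.
      have -> : (if rep x i == b then a else rep x i) = a.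
        by case: (eqVneq (rep x i) b) iab => // _; rewrite orbF => /eqP.
      by case: (eqVneq (rep x j) b) => [_|]; rewrite ?eqxx ?orbT ?orbF.
    move=> niab; have [bi _] := block_mem i xw; apply/orP; left.
    have -> : ([set j | merge_at_rep x (a, b, u) j == merge_at_rep x (a, b, u) i],
      inord (merge_at_wt x (a, b, u) i)) = block x i.
      rewrite /merge_at_wt (negbTE niab) inord_val [RHS]surjective_pairing block1E //.
      congr (_, _); apply/setP => j; rewrite !inE /merge_at_rep /=.
      move: niab; rewrite negb_or => /andP[na nb]; rewrite (negbTE nb).
      case: (eqVneq (rep x j) b) => [->|//].
      by rewrite [a == _]eq_sym [b == _]eq_sym (negbTE na) (negbTE nb).
    move: niab; rewrite negb_or => /andP[na nb].
    by rewrite bi !eq_block // ra rb na nb.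
  case/orP=> [/and3P[qb qa qx]|/eqP ->].
    have /and3P[/forallP/(_ q)] := xw; rewrite qx /= => /andP[/set0Pn[i iq] _] _ _.
    have e := block_eq xw qx iq.
    move: qa qb; rewrite -e !eq_block // ra rb => na nb.
    exists i => //; rewrite /merge_at_wt /= (negbTE na) (negbTE nb) /= inord_val.
    rewrite [LHS]surjective_pairing block1E //.
    congr (_, _); apply/setP => j; rewrite !inE /merge_at_rep /=.
    rewrite (negbTE nb).
    case: (eqVneq (rep x j) b) => [->|//].
    by rewrite [a == _]eq_sym [b == _]eq_sym (negbTE na) (negbTE nb).
  exists a => //; rewrite wa /p; congr (_, _).
  apply/setP => j; rewrite !inE !mem_block // /merge_at_rep /= ra rb nab.
  by case: (eqVneq (rep x j) b) => [_|]; rewrite ?eqxx ?orbT ?orbF.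
apply/existsP/eqP => [[w /andP[/eqP ew /eqP ->]]|->].
  by congr (_ :|: [set (_, _)]); apply: val_inj; rewrite /= inordK.
by exists (inord (wt x a + wt x b + u)); rewrite /= inordK // -/(wt x a) -/(wt x b) !eqxx.
Qed.

Lemma wmergeC x y p q u : wmerge x y p q u = wmerge x y q p u.
Proof.
rewrite /wmerge andbCA [p == q]eq_sym; do 3 congr (_ && _).
apply: eq_existsb => w; rewrite [p.2 + _]addnC setUC [p.1 :|: _]setUC.
by rewrite [_ :|: [set _]]setUC !setDDl [[set p] :|: _]setUC.
Qed.

Lemma wmerge_letter x y p q u : is_wpart x -> wmerge x y p q u ->
  bmin p.1 < bmin q.1 -> exists l, [/\ mergeable x l, p = block x l.1.1, q =
    block x l.1.2,
    u = l.2 & y = merge_at x l].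
Proof.
move=> xw m; have /and4P[px qx _ _] := m.
have mem_ex t : t \in x -> exists2 i, t = block x i & rep x i = i.
  move=> tx; have /and3P[/forallP/(_ t)] := xw.
  rewrite tx /= => /andP[/set0Pn[i iq] _] _ _; exists (rep x i).
    by rewrite rep_block // (block_eq xw tx iq).
  exact: (rep_idem (wpart_rep_ok xw)).
have [a pa ra] := mem_ex p px; have [b qb rb] := mem_ex q qx.
rewrite pa qb !bmin_block // ra rb => ab.
have fl : mergeable x (a, b, u) by rewrite /mergeable /= ra rb !eqxx.
exists (a, b, u); split=> //=; apply/eqP; rewrite -wmerge_merge_at // -pa -qb //.
Qed.

Lemma wcovP x y : reflect (is_wpart x /\ exists2 l, mergeable x l & y =
  merge_at x l) (wcov x y).
Proof.
apply: (iffP and3P) => [[xw yw /existsP[p /existsP[q /existsP[u m]]]]|].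
  split=> //; have /and4P[px qx pq _] := m.
  have [lt_pq|] := ltnP (bmin p.1) (bmin q.1).
    by have [l [fl _ _ _ ->]] := wmerge_letter xw m lt_pq; exists l.
  rewrite leq_eqVlt => /orP[/eqP e|lt_qp]; last first.
    rewrite wmergeC in m.
    by have [l [fl _ _ _ ->]] := wmerge_letter xw m lt_qp; exists l.
  (* Blocks with equal minima coincide, against [pq]. *)
  have /and3P[/forallP fx _ _] := xw.
  have /andP[/set0Pn[i ip] _] := implyP (fx p) px.
  have /andP[/set0Pn[j jq] _] := implyP (fx q) qx.
  move: e pq; rewrite -(block_eq xw px ip) -(block_eq xw qx jq) !bmin_block // => e.
  by rewrite eq_block // (val_inj e) eqxx.
case=> xw [[[a b] u] fl ->]; split=> //; first exact: merge_at_wpart.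
apply/existsP; exists (block x a); apply/existsP; exists (block x b).
by apply/existsP; exists u; rewrite wmerge_merge_at.
Qed.

(** * Labels and the order of letters *)

Definition label_of l : label := ((l.1.1).+1, (l.1.2).+1, l.2).

Lemma label_of_inj : injective label_of.
Proof. by move=> [[a b] u] [[c d] v] [/val_inj -> /val_inj -> ->]. Qed.

(** The choice made by [pick] is harmless: by [merge_at_inj] the cover determines its letter. *)
Lemma lamE_merge_at x l : is_wpart x -> mergeable x l -> lamE x (merge_at x l) =
  label_of l.
Proof.
move=> xw fl; rewrite /lamE; case: pickP => [q /andP[m lt_q]|].
  have [k [fk -> -> -> /(merge_at_inj xw fl fk) <-]] := wmerge_letter xw m lt_q.
  by have /and3P[/eqP ra /eqP rb _] := fl; rewrite !bmin_block // ra rb.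
case: l fl => -[a b] u fl /(_ (block x a, block x b, u)) /=.
have /and3P[/= /eqP ra /eqP rb ab] := fl.
by rewrite wmerge_merge_at // eqxx !bmin_block // ra rb ab.
Qed.

Definition letter_lt l m := lab_lt (label_of l) (label_of m).

Lemma letter_ltE l m : letter_lt l m = (l.1.1 < m.1.1) ||
  [&& l.1.1 == m.1.1, l.1.2 <= m.1.2, (l.2 <= m.2)%N & l != m].
Proof.
rewrite /letter_lt /lab_lt (inj_eq label_of_inj).
case: l m => -[a b] u [[c d] v]; rewrite /lab_le /= !ltnS eqSS.
rewrite -(inj_eq val_inj a c) /=; case: ltngtP => //= [lt_ac|_]; last by rewrite andbA.
by apply/eqP => -[e _ _]; rewrite e ltnn in lt_ac.
Qed.

Lemma letter_lt_irr : irreflexive letter_lt.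
Proof. by move=> l; rewrite letter_ltE ltnn !eqxx !andbF. Qed.

Lemma letter_lt_trans : transitive letter_lt.
Proof.
move=> m l k; rewrite !letter_ltE.
case/orP=> [lm|/and4P[/eqP e1 b1 u1 n1]] /orP[wpart_of'|/and4P[/eqP e2 b2 u2 n2]].
- by rewrite (ltn_trans lm wpart_of').
- by rewrite -e2 lm.
- by rewrite e1 wpart_of'.
rewrite e1 e2 eqxx (leq_trans b1 b2) (leq_trans u1 u2) /=; apply/orP; right.
apply: contraNneq n1 => e; rewrite -e in e2 b2 u2; clear n2 e.
case: l m e1 e2 b1 b2 u1 u2 => -[a b] u [[c d] v] /= -> _ b1 b2 u1 u2.
have -> : b = d by apply: val_inj; apply/eqP; rewrite eqn_leq b1.
by case: u v u1 u2 => [] [].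
Qed.

Lemma letter_lt_asym l m : letter_lt l m -> ~~ letter_lt m l.
Proof. by move=> lm; apply/negP => /(letter_lt_trans lm); rewrite letter_lt_irr. Qed.

(** * Words of merges and the number of blocks *)

Fixpoint mergeable_word x w : bool := if w is l :: w' then mergeable x l &&
  mergeable_word (merge_at x l) w' else true.
Definition merges x w := foldl merge_at x w.

Lemma merges_cat x v w : merges x (v ++ w) = merges (merges x v) w.
Proof. exact: foldl_cat. Qed.

Lemma mergeable_word_cat x v w : mergeable_word x (v ++ w) = mergeable_word x v &&
  mergeable_word (merges x v) w.
Proof. by elim: v x => //= l v IH x; rewrite IH andbA. Qed.

Lemma merges_wpart x w : is_wpart x -> mergeable_word x w -> is_wpart (merges x w).
Proof. by elim: w x => //= l w IH x xw /andP[fl]; apply: IH; apply: merge_at_wpart. Qed.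

(** Counts blocks by their minima. Each merge lowers it by one, so words with the same two ends have
    the same length. *)
Definition nblocks x := #|[set i | rep x i == i]|.

Lemma nblocks_le x : nblocks x <= n.
Proof. by have := max_card [set i | rep x i == i]; rewrite card_ord. Qed.

Lemma nblocks_merge_at x l : is_wpart x -> mergeable x l -> nblocks x =
  (nblocks (merge_at x l)).+1.
Proof.
move=> xw fl; have /and3P[/eqP ra /eqP rb ab] := fl.
have nab : (l.1.1 == l.1.2) = false by apply/negbTE; rewrite neq_ltn ab.
rewrite /nblocks (cardsD1 l.1.2) inE rb eqxx add1n; congr _.+1; apply: eq_card => i.
rewrite !inE rep_merge_at //; case: (eqVneq (rep x i) l.1.2) => [e|nb].
  rewrite e; have [-> | ni] := eqVneq i l.1.2; first by rewrite nab ?eqxx ?andbF.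
  by rewrite /= [_ == i]eq_sym; apply/esym/eqP => ei; move: nab; rewrite -e ei ra eqxx.
by case: (eqVneq i l.1.2) => // ei; rewrite ei rb eqxx in nb.
Qed.

Lemma nblocks_merges x w : is_wpart x -> mergeable_word x w -> nblocks x =
  nblocks (merges x w) + size w.
Proof.
elim: w x => [|l w IH] x xw /=; first by rewrite addn0.
by move=> /andP[fl fw]; rewrite (nblocks_merge_at xw fl) IH ?merge_at_wpart // addnS.
Qed.

(** * Rewriting two consecutive merges *)

Lemma mergeable_merge_at x l m : is_wpart x -> mergeable x l ->
  mergeable (merge_at x l) m = [&& mergeable x m, m.1.1 != l.1.2 & m.1.2 != l.1.2].
Proof.
move=> xw fl; have /and3P[/eqP ra /eqP rb ab] := fl.
have nab : (l.1.1 == l.1.2) = false by apply/negbTE; rewrite neq_ltn ab.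
have mins i : (rep (merge_at x l) i == i) = (rep x i == i) && (i != l.1.2).
  rewrite rep_merge_at //; case: (eqVneq (rep x i) l.1.2) => [e|nb].
    rewrite e; have [-> | ni] := eqVneq i l.1.2.
      by rewrite nab ?eqxx ?andbF.
    rewrite /=; apply/eqP => ei.
    by move: nab; rewrite -e -ei ra eqxx.
  have [ei|_] := eqVneq i l.1.2; last by rewrite andbT.
  by rewrite ei rb eqxx in nb.
rewrite /mergeable (mins m.1.1) (mins m.1.2); apply/and3P/and3P.
  by case=> /andP[-> ->] /andP[-> ->] ->.
by case=> /and3P[-> -> ->] -> ->.
Qed.

(** Splits on every equality test between ordinal variables, leaving trivial or arithmetic goals. *)
Ltac case_ordinals := repeat
  match goal with
  | |- context [@eq_op _ ?a ?b] =>
      is_var a; is_var b; match type of a with ordinal _ =>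
        have [?|?] := eqVneq a b; rewrite /=; subst; rewrite ?eqxx /=
      end
  end;
  try match goal with H : is_true (?a != ?a) |- _ => by rewrite eqxx in H end;
  try done; try lia.

(** Merges into a common block commute too; the only obstruction is that the second merge absorbs
    the block built by the first. *)
Lemma merge_at_swap x l m : is_wpart x -> mergeable x l -> mergeable (merge_at x l) m ->
  l.1.1 != m.1.2 ->
  [/\ mergeable x m, mergeable (merge_at x m) l & merge_at (merge_at x m) l =
    merge_at (merge_at x l) m].
Proof.
move=> xw fl fm; have := fm; rewrite mergeable_merge_at // => /and3P[fxm n1 n2] n3.
have fl' : mergeable (merge_at x m) l by rewrite mergeable_merge_at // fl n3 eq_sym n2.
split=> //; have xlw := merge_at_wpart xw fl; have xmw := merge_at_wpart xw fxm.
case: l m fl fm fxm n1 n2 n3 fl' xlw xmw =>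
  -[a b] u [[c d] v] /= fl fm fxm n1 n2 n3 fl' xlw xmw.
have /and3P[/= /eqP ra /eqP rb ab] := fl.
have /and3P[/= /eqP rc /eqP rd cd] := fxm.
have nab : a != b by rewrite neq_ltn ab.
have ncd : c != d by rewrite neq_ltn cd.
apply: wpart_ext => [||i|i]; try exact: merge_at_wpart.
  rewrite !rep_merge_at //=; move: (rep x i) => r;
    clear fl fm fxm fl' xlw xmw ra rb rc rd.
  by case_ordinals.
rewrite !wt_merge_at // !rep_merge_at //= !ra !rb !rc !rd.
move: (rep x i) (wt x i) => r v0; clear fl fm fxm fl' xlw xmw ra rb rc rd.
by case_ordinals.
Qed.

(** In an ascent the first root is at most the second, which lies below the minimum it absorbs;
    hence every ascent can be swapped. *)
Lemma letter_lt_neq x l m : mergeable x m -> letter_lt l m -> l.1.1 != m.1.2.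
Proof.
move=> /and3P[_ _ mm]; rewrite letter_ltE neq_ltn => /orP[lm|/andP[/eqP -> _]].
  by rewrite (ltn_trans lm).
by rewrite mm.
Qed.

(** The non-commuting case: rather than [b] into [a] and then [a] into [c], absorb [a] and then [b]
    into [c]. The total increment is the same and the first letter gets smaller, as [c < a]. *)
Lemma merge_at_chain x a b c u v : is_wpart x -> mergeable x (a, b, u) ->
  mergeable (merge_at x (a, b, u)) (c, a, v) ->
  [/\ mergeable x (c, a, u), mergeable (merge_at x (c, a, u)) (c, b, v) &
      merge_at (merge_at x (c, a, u)) (c, b, v) = merge_at (merge_at x (a, b, u)) (c,
        a, v)].
Proof.
move=> xw fl fm; have := fm; rewrite mergeable_merge_at //= => /and3P[fxm n1 n2].
have /and3P[/= /eqP ra /eqP rb ab] := fl.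
have /and3P[/= /eqP rc _ ca] := fxm.
have fl1 : mergeable x (c, a, u) by rewrite /mergeable /= rc ra ca !eqxx.
have fl2 : mergeable (merge_at x (c, a, u)) (c, b, v).
  rewrite mergeable_merge_at //= /mergeable /= rc rb !eqxx (ltn_trans ca ab).
  by rewrite !neq_ltn ca ab orbT.
split=> //; have xlw := merge_at_wpart xw fl; have xmw := merge_at_wpart xw fl1.
have nab : a != b by rewrite neq_ltn ab.
have nca : c != a by rewrite neq_ltn ca.
apply: wpart_ext => [||i|i]; try exact: merge_at_wpart.
  rewrite !rep_merge_at //=; move: (rep x i) => r;
    clear fl fm fxm fl1 fl2 xlw xmw ra rb rc.
  by case_ordinals.
rewrite !wt_merge_at // !rep_merge_at //= !ra !rb !rc.
move: (rep x i) (wt x i) => r v0; clear fl fm fxm fl1 fl2 xlw xmw ra rb rc.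
by case_ordinals.
Qed.

(** Both merges feed the same block, so only the sum of the increments matters. *)
Lemma merge_at_star x a b d : is_wpart x -> mergeable x (a, b, true) ->
  mergeable (merge_at x (a, b, true)) (a, d, false) ->
  [/\ mergeable x (a, b, false), mergeable (merge_at x (a, b, false)) (a, d, true) &
      merge_at (merge_at x (a, b, false)) (a, d, true) = merge_at (merge_at x (a, b,
        true)) (a, d, false)].
Proof.
move=> xw fl fm; have := fm; rewrite mergeable_merge_at //= => /and3P[fxm n1 n2].
have /and3P[/= /eqP ra /eqP rb ab] := fl.
have /and3P[/= _ /eqP rd ad] := fxm.
have fl1 : mergeable x (a, b, false) by [].
have fl2 : mergeable (merge_at x (a, b, false)) (a, d,
  true) by rewrite mergeable_merge_at //= n1 n2 !andbT.
split=> //; have xlw := merge_at_wpart xw fl; have xmw := merge_at_wpart xw fl1.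
have nab : a != b by rewrite neq_ltn ab.
have nad : a != d by rewrite neq_ltn ad.
apply: wpart_ext => [||i|i]; try exact: merge_at_wpart.
  by rewrite !rep_merge_at.
rewrite !wt_merge_at // !rep_merge_at //= !ra !rd.
move: (rep x i) (wt x i) => r v0; clear fl fm fxm fl1 fl2 xlw xmw ra rb rd.
by case_ordinals.
Qed.

(** * Straightening a word into an increasing one *)

Definition lcode l : nat := (l.1.1 * n + l.1.2) * 2 + l.2.

Lemma lcode_lt l : lcode l < n * n * 2.
Proof.
case: l => -[a b] u; rewrite /lcode /=.
have la := ltn_ord a; have lb := ltn_ord b; have := leq_mul la (leqnn n).
by rewrite mulSn; case: u => /= h; lia.
Qed.

(* Lexicographic rank of a word among the words of the same length. *)
Fixpoint wcode w : nat := if w is l :: w' then lcode l * (n * n * 2) ^ size w' + wcode w' else 0.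

Lemma wcode_lt w : wcode w < (n * n * 2) ^ size w.
Proof.
elim: w => //= l w IH; have := lcode_lt l; rewrite expnS.
move: IH; move: (n * n * 2) (_ ^ _) (lcode l) (wcode w) => K S c k kS cK.
by have := leq_mul cK (leqnn S); rewrite mulSn; lia.
Qed.

Lemma wcode_cons_lt l m v w : size v = size w -> lcode l < lcode m ->
  wcode (l :: v) < wcode (m :: w).
Proof.
move=> s lm /=; rewrite -s; have := wcode_lt v;
  have := leq_mul lm (leqnn ((n * n * 2) ^ size v)).
by rewrite mulSn; lia.
Qed.

Lemma lcode_lt_a l m : l.1.1 < m.1.1 -> lcode l < lcode m.
Proof.
case: l m => -[a b] u [[c d] v] /= ac; rewrite /lcode /=.
have := leq_mul ac (leqnn n); rewrite mulSn; have := ltn_ord b.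
by case: u; case: v => /=; lia.
Qed.

(** With equal roots, either the absorbed minima descend and the letters are swapped, or the
    increments descend and are traded. With a smaller second root, use [merge_at_chain] if the first
    root is absorbed, and swap otherwise. *)
Lemma straighten2 x l m : is_wpart x -> mergeable x l -> mergeable (merge_at x l) m ->
  ~~ letter_lt l m ->
  exists l' m', [/\ mergeable x l', mergeable (merge_at x l') m',
    merge_at (merge_at x l') m' = merge_at (merge_at x l) m & lcode l' < lcode l].
Proof.
move=> xw fl fm; rewrite letter_ltE negb_or -leqNgt leq_eqVlt =>
  /andP[/orP[/eqP e nlm|ma _]].
  have e' : m.1.1 = l.1.1 by apply: val_inj.
  case: l m fl fm {e} e' nlm => -[a b] u [[c d] v] /= fl fm e nlm.
  rewrite e in fm nlm *; have := fm; rewrite mergeable_merge_at //= => /and3P[fxm n1 n2].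
  have [db|bd] := ltnP d b.
    have [//|f1 f2 e2] := merge_at_swap xw fl fm _.
      by have /and3P[/= _ _] := fxm; rewrite neq_ltn => ->.
    exists (a, d, v), (a, b, u); split; [exact: f1|exact: f2|exact: e2|].
    by clear -db; rewrite /lcode /=; case: u; case: v => /=; lia.
  (* The absorbed minima ascend and differ, so only the increments can prevent an ascent. *)
  have uv : u = true /\ v = false.
    move: nlm; rewrite eqxx bd /=; by case: u v {fl fm fxm} =>
      [] [] //= /negPn/eqP -[/eqP];
      rewrite eq_sym (negbTE n2).
  case: uv fl fm => -> -> fl fm; have [f1 f2 e2] := merge_at_star xw fl fm.
  exists (a, b, false), (a, d, true); split; [exact: f1|exact: f2|exact: e2|].
  by rewrite /lcode /= addn0 addn1.
have [e|ne] := eqVneq l.1.1 m.1.2.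
  case: l m fl fm ma e => -[a b] u [[c d] v] /= fl fm ma e.
  rewrite -e in fm *; have [f1 f2 e2] := merge_at_chain xw fl fm.
  by exists (c, a, u), (c, b, v); split=> //; apply: lcode_lt_a.
have [f1 f2 e2] := merge_at_swap xw fl fm ne.
by exists m, l; split=> //; apply: lcode_lt_a.
Qed.

(** Rewriting the first non-ascent lowers its first letter and keeps all earlier ones, so the code
    falls whatever follows. *)
Lemma straighten x w : is_wpart x -> mergeable_word x w -> ~~ sorted letter_lt w ->
  exists w', [/\ mergeable_word x w', merges x w' = merges x w, size w' = size w &
    wcode w' < wcode w].
Proof.
elim: w x => [|l [|m w] IH] x xw //= /andP[fl fw].
have [lm /= nw|nlm _] := boolP (letter_lt l m).
  have [w' [fw' ew sw cw]] := IH _ (merge_at_wpart xw fl) fw nw.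
  by exists (l :: w'); rewrite /= fl fw' ew sw ltn_add2l.
have /andP[fm fw2] := fw.
have [l' [m' [f1 f2 e c]]] := straighten2 xw fl fm nlm.
exists [:: l', m' & w]; split=> //; first by rewrite /= f1 f2 e.
  by rewrite /merges /= e.
exact: (@wcode_cons_lt l' l (m' :: w) (m :: w)).
Qed.

Lemma increasing_word x w : is_wpart x -> mergeable_word x w ->
  exists w', [/\ mergeable_word x w', merges x w' = merges x w & sorted letter_lt w'].
Proof.
move=> xw; have [k] := ubnP (wcode w); elim: k w => // k IH w lt_k fw.
have [sw|nsw] := boolP (sorted letter_lt w); first by exists w.
have [w' [fw' ew _ cw]] := straighten xw fw nsw.
have [|w2 [f2 e2 s2]] := IH w' _ fw'; first by lia.
by exists w2; rewrite e2.
Qed.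

(** * Uniqueness of the increasing word *)

Lemma mergeable_word_all x w : is_wpart x -> mergeable_word x w -> all (mergeable x) w.
Proof.
elim: w x => //= l w IH x xw /andP[fl fw]; rewrite fl /=.
apply: sub_all (IH _ (merge_at_wpart xw fl) fw) => m.
by rewrite mergeable_merge_at // => /and3P[].
Qed.

Lemma mergeable_word_cons_neq x l w m : is_wpart x -> mergeable_word x (l :: w) ->
  m \in w ->
  [/\ mergeable x m, m.1.1 != l.1.2 & m.1.2 != l.1.2].
Proof.
move=> xw /= /andP[fl fw] /(allP (mergeable_word_all (merge_at_wpart xw fl) fw)).
by rewrite mergeable_merge_at // => /and3P[].
Qed.

Lemma rep_merges_rep x w i : is_wpart x -> mergeable_word x w ->
  rep (merges x w) (rep x i) = rep (merges x w) i.
Proof.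
elim: w x i => [|l w IH] x i xw /=; first by rewrite (rep_idem (wpart_rep_ok xw)).
move=> /andP[fl fw]; have xlw := merge_at_wpart xw fl.
by rewrite -(IH _ (rep x i)) // -(IH _ i) // !rep_merge_at // (rep_idem (wpart_rep_ok xw)).
Qed.

Lemma rep_merges_id x w i : is_wpart x -> mergeable_word x w -> rep x i = i ->
  i \notin [seq l.1.2 | l <- w] -> rep (merges x w) i = i.
Proof.
elim: w x => [|l w IH] x xw //= /andP[fl fw] ri; rewrite inE negb_or => /andP[ib iw].
by apply: IH => //; [exact: merge_at_wpart | rewrite rep_merge_at // ri (negbTE ib)].
Qed.

(* Along an increasing word the roots only absorb, they are never absorbed. *)
Lemma increasing_star x w l m : is_wpart x -> mergeable_word x w -> sorted letter_lt w ->
  l \in w -> m \in w -> l.1.1 != m.1.2.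
Proof.
elim: w x l m => // k w IH x l m xw fw; have /= /andP[fk fw'] := fw => sw.
have kw := order_path_min letter_lt_trans sw.
have sw' := path_sorted sw.
have ka q : q \in w -> k.1.1 <= q.1.1.
  by move/(allP kw); rewrite letter_ltE => /orP[/ltnW//|/andP[/eqP -> _]].
have lt_mergeable q : mergeable x q -> q.1.1 < q.1.2 by case/and3P.
rewrite !inE => /orP[/eqP ->|lw] /orP[/eqP ->|mw].
- by rewrite neq_ltn lt_mergeable.
- have [fm _ _] := mergeable_word_cons_neq xw fw mw.
  by rewrite neq_ltn (leq_ltn_trans (ka _ mw)) ?lt_mergeable.
- by have [] := mergeable_word_cons_neq xw fw lw.
- exact: (IH _ _ _ (merge_at_wpart xw fk) fw' sw').
Qed.

(** The root is never absorbed, by [increasing_star], so it stays the minimum of its block to the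
    end. *)
Lemma rep_merges_increasing x w l : is_wpart x -> mergeable_word x w ->
  sorted letter_lt w ->
  l \in w -> rep (merges x w) l.1.2 = l.1.1.
Proof.
elim: w x => // k w IH x xw fw; have /= /andP[fk fw'] := fw => sw.
have xkw := merge_at_wpart xw fk; rewrite inE => /orP[/eqP ->|]; last first.
  by apply: IH => //; apply: path_sorted sw.
have /and3P[/eqP ra /eqP rb ab] := fk.
have nab : (k.1.1 == k.1.2) = false by apply/negbTE; rewrite neq_ltn ab.
rewrite -rep_merges_rep // rep_merge_at // rb eqxx rep_merges_id //.
  by rewrite rep_merge_at // ra nab.
apply/mapP => -[q qw e];
  have := increasing_star xw fw sw (mem_head _ _) (_ : q \in k :: w).
by rewrite inE qw orbT e eqxx => /(_ isT).
Qed.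

(** By [increasing_star] an absorbed block has absorbed nothing before, so it still carries its
    weight in [x]. *)
Lemma wt_merges_increasing x w a : is_wpart x -> mergeable_word x w ->
  sorted letter_lt w ->
  rep x a = a -> a \notin [seq l.1.2 | l <- w] ->
  wt (merges x w) a = wt x a + \sum_(l <- w | l.1.1 == a) (wt x l.1.2 + l.2).
Proof.
elim: w x => [|k w IH] x xw fw sw ra; first by rewrite big_nil addn0.
rewrite /= inE negb_or => /andP[ak aw]; have /= /andP[fk fw'] := fw.
have xkw := merge_at_wpart xw fk.
rewrite IH ?(path_sorted sw) //; last by rewrite rep_merge_at // ra (negbTE ak).
rewrite big_cons wt_merge_at // ra (negbTE ak) orbF.
have -> : \sum_(l <- w | l.1.1 == a) (wt (merge_at x k) l.1.2 + l.2) =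
          \sum_(l <- w | l.1.1 == a) (wt x l.1.2 + l.2).
  rewrite big_seq_cond [RHS]big_seq_cond; apply: eq_bigr => l /andP[lw _].
  have [/and3P[_ /eqP rb _] _ nb] := mergeable_word_cons_neq xw fw lw.
  rewrite wt_merge_at // rb (negbTE nb) orbF eq_sym.
  have := increasing_star xw fw sw (mem_head _ _) (_ : l \in k :: w).
  by rewrite inE lw orbT => /(_ isT) /negbTE ->.
by rewrite eq_sym; case: eqVneq => [->|//]; lia.
Qed.

(** Increments at a fixed root are nondecreasing along an increasing word. A leading 1 makes them
    all 1, the largest sum for that many letters, which a word with leading 0 cannot reach. *)
Lemma increasing_head_le w v l m : path letter_lt l w -> path letter_lt m v -> l.1 =
  m.1 ->
  [seq k.1 | k <- w] = [seq k.1 | k <- v] ->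
  \sum_(k <- l :: w | k.1.1 == l.1.1) (k.2 : nat) =
    \sum_(k <- m :: v | k.1.1 == l.1.1) (k.2 : nat) -> m.2 -> l.2.
Proof.
move=> pw pv e ewv; rewrite !big_cons -e eqxx => es m2; apply/negPn/negP => nl2.
move: es; rewrite m2 (negbTE nl2) add0n.
have -> : \sum_(k <- v | k.1.1 == l.1.1) (k.2 : nat) = count (fun k => k.1.1 == l.1.1) v.
  rewrite -sum1_count big_seq_cond [RHS]big_seq_cond; apply: eq_bigr =>
    k /andP[kv /eqP ka].
  have := allP (order_path_min letter_lt_trans pv) _ kv;
    rewrite letter_ltE -e ka ltnn eqxx m2 /=.
  by case: (k.2) => //=; rewrite andbF.
have <- : count (fun k : letter => k.1.1 == l.1.1) w =
          count (fun k : letter => k.1.1 == l.1.1) v.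
  by rewrite -!(count_map fst (fun p : 'I_n * 'I_n => p.1 == l.1.1)) ewv.
suff : \sum_(k <- w | k.1.1 == l.1.1) (k.2 : nat) <= count (fun k => k.1.1 == l.1.1) w.
  by move=> le_w es; rewrite es add1n ltnn in le_w.
by rewrite -sum1_count; apply: leq_sum => k _; case: (k.2).
Qed.

(** At each root the increments form a nondecreasing 0/1 sequence of known length, determined by its
    sum. *)
Lemma increasing_eq w v : sorted letter_lt w -> sorted letter_lt v ->
  [seq l.1 | l <- w] = [seq l.1 | l <- v] ->
  {in [seq l.1.1 | l <- w], forall a,
    \sum_(l <- w | l.1.1 == a) (l.2 : nat) = \sum_(l <- v | l.1.1 == a) (l.2 : nat)} ->
  w = v.
Proof.
elim: w v => [|l w IH] [|m v] //= pw pv [e1 ewv] es.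
have e2 : l.2 = m.2.
  have := es l.1.1 (mem_head _ _) => esl.
  apply/idP/idP; last exact: (increasing_head_le pw pv).
  apply: (increasing_head_le pv pw) => //; by rewrite -e1.
have e : l = m by case: (l) (m) e1 e2 => ? ? [? ?] /= -> ->.
rewrite e; congr (_ :: _); apply: IH; rewrite ?(path_sorted pw) ?(path_sorted pv) //.
move=> a aw; have := es a; rewrite inE aw orbT !big_cons e => /(_ isT).
by case: ifP => // _; apply: addnI.
Qed.

Definition pair_lt (p q : 'I_n * 'I_n) := (p.1 < q.1) || (p.1 == q.1) && (p.2 < q.2).

Lemma pair_lt_trans : transitive pair_lt.
Proof.
move=> [c d] [a b] [e f]; rewrite /pair_lt /=.
case/orP=> [ac|/andP[/eqP -> bd]] /orP[ce|/andP[/eqP <- df]].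
- by rewrite (ltn_trans ac ce).
- by rewrite ac.
- by rewrite ce.
- by rewrite eqxx (ltn_trans bd df) orbT.
Qed.

(** The order of letters would allow a repeated pair with a larger increment, but a minimum is
    absorbed only once. *)
Lemma pairs_sorted x w : is_wpart x -> mergeable_word x w -> sorted letter_lt w ->
  sorted pair_lt [seq l.1 | l <- w].
Proof.
elim: w x => [|l [|m w] IH] x xw // fw /= /andP[lm sw].
have /= /andP[fl fw'] := fw; apply/andP; split; last exact: (IH _ (merge_at_wpart xw fl)).
have [_ _ nb] := mergeable_word_cons_neq xw fw (mem_head _ _).
move: lm; rewrite letter_ltE /pair_lt => /orP[-> //|/and4P[-> le_b _ _]].
by rewrite [l.1.2 < _]ltn_neqAle val_eqE eq_sym nb le_b orbT.
Qed.

(** The pairs depend on the two ends only: each minimum that disappears is absorbed directly by its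
    final representative. *)
Lemma mem_pairs x w p : is_wpart x -> mergeable_word x w -> sorted letter_lt w ->
  (p \in [seq l.1 | l <- w]) =
    [&& rep x p.2 == p.2, rep (merges x w) p.2 == p.1 & p.1 != p.2].
Proof.
move=> xw fw sw; apply/mapP/and3P => [[l lw ->]|[/eqP rb /eqP ra nab]].
  have /and3P[_ rb ab] := allP (mergeable_word_all xw fw) _ lw.
  by rewrite rb rep_merges_increasing // eqxx neq_ltn ab.
have /mapP[l lw e] : p.2 \in [seq l.1.2 | l <- w].
  by apply: contraNT nab => pb; rewrite -ra rep_merges_id.
exists l => //; have := rep_merges_increasing xw fw sw lw; rewrite -e ra.
by case: (p) (l.1) e => [? ?] [? ?] /= -> ->.
Qed.

(** The ends fix the sorted list of pairs and, through the final weights, the sum of increments at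
    each root. *)
Lemma increasing_word_uniq x w v : is_wpart x -> mergeable_word x w ->
  mergeable_word x v ->
  sorted letter_lt w -> sorted letter_lt v -> merges x w = merges x v -> w = v.
Proof.
move=> xw fw fv sw sv e.
have ewv : [seq l.1 | l <- w] = [seq l.1 | l <- v].
  apply: (irr_sorted_eq pair_lt_trans); rewrite ?(pairs_sorted xw) //.
    by move=> p; rewrite /pair_lt !ltnn andbF.
  by move=> p; rewrite !(mem_pairs _ xw) // e.
have bsE : [seq l.1.2 | l <- w] = [seq l.1.2 | l <- v].
  by have := congr1 (map snd) ewv; rewrite -!map_comp.
apply: increasing_eq => // a /mapP[l lw ->].
have /and3P[/eqP ra _ _] := allP (mergeable_word_all xw fw) _ lw.
have aw : l.1.1 \notin [seq l.1.2 | l <- w].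
  by apply/mapP => -[m mw em]; have := increasing_star xw fw sw lw mw; rewrite em eqxx.
have := wt_merges_increasing xw fw sw ra aw; rewrite e wt_merges_increasing -?bsE //.
move/addnI; rewrite !big_split /=.
(* The initial weights depend only on the common list of pairs and cancel. *)
suff -> : \sum_(k <- v | k.1.1 == l.1.1) wt x k.1.2 =
          \sum_(k <- w | k.1.1 == l.1.1) wt x k.1.2 by move/addnI.
have pairs (s : seq letter) : \sum_(k <- s | k.1.1 == l.1.1) wt x k.1.2 =
    \sum_(p <- [seq k.1 | k <- s] | p.1 == l.1.1) wt x p.2 by rewrite big_map.
by rewrite !pairs ewv.
Qed.

(** * The bottom element and reachability *)

Lemma wbot_wpart_of : wbot n = wpart_of id (fun=> 0).
Proof.
apply: eq_imset => i; congr (_, _); first by apply/setP => j; rewrite !inE.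
by apply: val_inj; rewrite /= inordK.
Qed.

Lemma id_rep_ok : rep_ok (@id 'I_n) (fun=> 0).
Proof. by split=> // i; apply/card_gt0P; exists i; rewrite inE. Qed.

Lemma wbot_wpart : is_wpart (wbot n).
Proof. by rewrite wbot_wpart_of; apply/wpart_of_wpart/id_rep_ok. Qed.

Lemma rep_wbot i : rep (wbot n) i = i.
Proof. by rewrite wbot_wpart_of rep_wpart_of //; apply: id_rep_ok. Qed.

Lemma wt_wbot i : wt (wbot n) i = 0.
Proof. by rewrite wbot_wpart_of wt_wpart_of //; apply: id_rep_ok. Qed.

Lemma nblocks_wbot : nblocks (wbot n) = n.
Proof.
rewrite /nblocks -[RHS]card_ord -cardsT; apply: eq_card => i.
by rewrite !inE rep_wbot eqxx.
Qed.

(** Undoes a merge by splitting [b] off as a singleton of weight 0. The increment is 1 exactly when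
    the block has maximal weight, which it could not carry without [b]. *)
Lemma merge_at_preimage x b : is_wpart x -> rep x b != b ->
  exists y l, [/\ is_wpart y, mergeable y l & merge_at y l = x].
Proof.
move=> xw nab; have ok := wpart_rep_ok xw; set a := rep x b.
have rr i : rep x (rep x i) = rep x i := rep_idem ok i.
have rb i : (rep x i == b) = false by apply: contraNF nab => /eqP <-; rewrite rr.
have ab : a < b by rewrite ltn_neqAle (rep_le ok) andbT.
pose cl := #|[set j | rep x j == a]|; pose u := wt x a == cl.-1.
have cl_b : cl = #|[set j | rep x j == a] :\ b|.+1.
  by rewrite /cl (cardsD1 b) inE eqxx.
have cl_gt1 : 1 < cl.
  by rewrite cl_b ltnS; apply/card_gt0P; exists a; rewrite !inE rr eqxx andbT neq_ltn ab.
have wa : wt x a < cl by have := wt_lt ok a; rewrite rr.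
pose r i := if i == b then b else rep x i.
pose v i := if i == b then 0 else if rep x i == a then wt x a - u else wt x i.
have okr : rep_ok r v.
  split=> i; rewrite /r /v.
  - by case: (eqVneq i b) => [|_]; rewrite ?eqxx // rb rr.
  - by case: (eqVneq i b) => [->|_] //; apply: (rep_le ok).
  - by case: (eqVneq i b) => [|_]; rewrite ?eqxx // rb rr (wt_rep ok).
  case: (eqVneq i b) => [_|ib]; first by apply/card_gt0P; exists b; rewrite inE !eqxx.
  case: (eqVneq (rep x i) a) => [->|ia].
    suff -> : [set j | (if j == b then b else rep x j) == a] =
      [set j | rep x j == a] :\ b.
      by move: wa cl_gt1; rewrite /u cl_b /=; case: eqVneq => /=; lia.
    apply/setP => j; rewrite !inE; case: (eqVneq j b) => //= _.
    by apply/negbTE; rewrite neq_ltn ab orbT.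
  apply: leq_trans (wt_lt ok i) _; apply: subset_leq_card; apply/subsetP => j.
  rewrite !inE; case: (eqVneq j b) => // -> /eqP e.
  by rewrite -e eqxx in ia.
have yw := wpart_of_wpart okr.
have fl : mergeable (wpart_of r v) (a, b, u).
  by rewrite /mergeable /= !rep_wpart_of // /r eqxx rb rr !eqxx.
exists (wpart_of r v), (a, b, u); split=> //; apply: wpart_ext => // [|i|i].
- exact: merge_at_wpart.
- rewrite rep_merge_at // rep_wpart_of //= /r.
  by case: (eqVneq i b) => [->|_]; rewrite ?eqxx ?rb.
rewrite wt_merge_at // !rep_wpart_of // !wt_wpart_of //= /r /v eqxx rr eqxx rb addn0.
have ua : u <= wt x a by rewrite /u; case: eqVneq => // ->; lia.
case: (eqVneq i b) => [->|ib]; first by rewrite eqxx orbT subnK // (wt_rep ok).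
rewrite rb orbF; case: (eqVneq (rep x i) a) => [e|//].
by rewrite subnK // -e (wt_rep ok).
Qed.

Lemma wbot_reach x : is_wpart x -> exists2 w, mergeable_word (wbot n) w &
  merges (wbot n) w = x.
Proof.
have [k] := ubnP (n - nblocks x); elim: k x => // k IH x lt_k xw.
have [/forallP idx|] := boolP [forall i, rep x i == i]; last first.
  rewrite negb_forall => /existsP[b nb].
  have [y [l [yw fl e]]] := merge_at_preimage xw nb.
  have [|//|w fw ew] := IH y.
    have := nblocks_merge_at yw fl; have := nblocks_le y; rewrite e; lia.
  by exists (rcons w l); rewrite -cats1 ?mergeable_word_cat ?merges_cat ?fw /= ew ?fl.
(* Only singletons remain, and their weights are forced to be 0. *)
exists [::] => //=; apply: wpart_ext => //; first exact: wbot_wpart.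
  by move=> i; rewrite rep_wbot (eqP (idx i)).
move=> i; rewrite wt_wbot; have := wt_lt (wpart_rep_ok xw) i.
have -> : [set j | rep x j == rep x i] = [set i].
  by apply/setP => j; rewrite !inE (eqP (idx i)) (eqP (idx j)).
by rewrite cards1; case: (wt x i).
Qed.

(** * The word model of weighted partitions *)

Lemma wleP x y : is_wpart x -> wle x y <-> exists2 w, mergeable_word x w & merges x w = y.
Proof.
move=> xw; split=> [/connectP[s]|[w fw <-]].
  elim: s x xw => [|z s IH] x xw /=; first by move=> _ ->; exists [::].
  case/andP=> /wcovP[_ [l fl ->]] p e.
  have [w fw ew] := IH _ (merge_at_wpart xw fl) p e.
  by exists (l :: w); rewrite /= ?fl.
elim: w x xw fw => [|l w IH] x xw /=; first by move=> _; apply: connect0.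
case/andP=> fl fw; apply: connect_trans (IH _ (merge_at_wpart xw fl) fw).
by apply: connect1; apply/wcovP; split=> //; exists l.
Qed.

(** The length bound [n] makes the list finite and loses no word, since each merge removes a
    block. *)
Definition words : seq (seq letter) :=
  [seq w <- map val (enum {: n.-bseq ('I_n * 'I_n * bool)}) | mergeable_word (wbot n) w].

Lemma mem_words w : (w \in words) = mergeable_word (wbot n) w.
Proof.
rewrite mem_filter; case: (boolP (mergeable_word _ w)) => //= fw; apply/mapP.
have sw : size w <= n.
  by have := nblocks_merges wbot_wpart fw; rewrite nblocks_wbot; lia.
by exists (Bseq sw); rewrite ?mem_enum.
Qed.

Lemma words_uniq : uniq words.
Proof. by apply: filter_uniq; rewrite map_inj_uniq ?enum_uniq //; apply: val_inj. Qed.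

Lemma wpart_model : word_model (wpart_set n) (@wle n) words (merges (wbot n)).
Proof.
split=> [|//|x|u v|u x|u w].
- exact: words_uniq.
- by rewrite mem_words.
- rewrite inE; split=> [/wbot_reach[w fw e]|[w]]; first by exists w; rewrite ?mem_words.
  by rewrite mem_words => fw <-; apply/merges_wpart/fw/wbot_wpart.
- by rewrite !mem_words mergeable_word_cat => /andP[].
- rewrite mem_words => fu _; have uw := merges_wpart wbot_wpart fu.
  apply: (iff_trans (wleP _ uw)); split=> -[v].
    by exists v; rewrite ?mem_words ?mergeable_word_cat ?merges_cat ?fu.
  by rewrite mem_words mergeable_word_cat merges_cat => /andP[_ fv] <-; exists v.
- rewrite !mem_words => fu fw e.
  by have := nblocks_merges wbot_wpart fu; rewrite e (nblocks_merges wbot_wpart fw) =>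
    /addnI.
Qed.

(** * Saturated chains and the EW-labeling *)

Local Notation cov := (pcover (wpart_set n) (@wle n)).

Lemma covP x y : reflect (is_wpart x /\ exists2 l, mergeable x l & y =
  merge_at x l) (cov x y).
Proof.
apply: (iffP (wm_coverP wpart_model _ _)).
  move=> [u [l [+ <- <-]]]; rewrite mem_words -cats1 mergeable_word_cat merges_cat /=.
  move=> /and3P[fu fl _]; split; last by exists l.
  exact: (merges_wpart wbot_wpart).
case=> xw [l fl ->]; have [u fu eu] := wbot_reach xw.
by exists u, l; rewrite mem_words -cats1 mergeable_word_cat merges_cat /= fu eu fl.
Qed.

(** With [chain_word], the dictionary between saturated chains and words of merges; it turns
    statements on label words into statements on letters. *)
Lemma word_chain x w : is_wpart x -> mergeable_word x w ->
  path cov x (scanl merge_at x w) /\ lword (@lamE n) x (scanl merge_at x w) =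
    [seq label_of l | l <- w].
Proof.
elim: w x => //= l w IH x xw /andP[fl fw].
have [p e] := IH _ (merge_at_wpart xw fl) fw; rewrite p e lamE_merge_at // andbT.
by split=> //; apply/covP; split=> //; exists l.
Qed.

Lemma chain_word x s : is_wpart x -> path cov x s ->
  exists2 w, mergeable_word x w & s = scanl merge_at x w.
Proof.
elim: s x => [|y s IH] x xw /=; first by exists [::].
case/andP=> /covP[_ [l fl ->]] /(IH _ (merge_at_wpart xw fl)) [w fw ->].
by exists (l :: w); rewrite //= fl.
Qed.

Lemma last_scanl x w : last x (scanl merge_at x w) = merges x w.
Proof. by elim: w x => //= l w IH x. Qed.

Lemma sorted_label_of w : sorted lab_lt [seq label_of l | l <- w] = sorted letter_lt w.
Proof. by rewrite sorted_map. Qed.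

Lemma increasing_word_exists_unique x y : is_wpart x -> wle x y ->
  exists! w, [/\ mergeable_word x w, merges x w = y & sorted letter_lt w].
Proof.
move=> xw /(wleP _ xw) [v fv <-]; have [w [fw ew sw]] := increasing_word xw fv.
exists w; split=> // t [ft et st]; apply: (increasing_word_uniq xw) => //.
by rewrite ew et.
Qed.

Lemma lamE_EW : EW_labeling (wpart_set n) (@wle n) lab_lt (@lamE n) (wbot n).
Proof.
split=> [x y|s b c|x y s t].
- rewrite !inE => xw yw /(increasing_word_exists_unique xw) [w [[fw ew sw] uw]].
  have [p e] := word_chain xw fw; exists (scanl merge_at x w); split.
    by rewrite /maxchain p last_scanl ew eqxx /increasing e sorted_label_of.
  move=> s /andP[/andP[ps /eqP ls]]; have [v fv es] := chain_word xw ps.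
  have [_ ev] := word_chain xw fv; rewrite es /increasing ev sorted_label_of => sv.
  by rewrite (uw v) //; split=> //; rewrite -last_scanl -es.
- move=> _ /covP[xw [l fl ->]] /covP[bw [m fm ->]]; move: (last _ _) xw fl bw fm =>
  x xw fl bw fm.
  rewrite !lamE_merge_at // => lm.
  have nlm : l.1.1 != m.1.2.
    by apply: (letter_lt_neq _ lm); have := fm; rewrite mergeable_merge_at // =>
      /and3P[fxm _ _]; exact: fxm.
  have [fxm fml e] := merge_at_swap xw fl fm nlm.
  have cov_st y k : is_wpart y -> mergeable y k -> cov y (merge_at y k).
    by move=> yw fk; apply/covP; split=> //; exists k.
  exists (merge_at x m); split.
    by rewrite lamE_merge_at // -e lamE_merge_at ?merge_at_wpart //; split=> //;
      apply: cov_st; rewrite ?merge_at_wpart.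
  (* The label fixes the letter, hence the new element. *)
  move=> b' [/covP[_ [k fk ->]] _]; rewrite lamE_merge_at // => /label_of_inj -> _ //.
- case: s t => [|z s] [|z' t] // ms mt; have xw : is_wpart x.
    by have /andP[/= /andP[/covP[]]] := ms.
  move: ms mt => /andP[ps _] /andP[pt _].
  have [w fw ->] := chain_word xw ps; have [v fv ->] := chain_word xw pt.
  have [_ ->] := word_chain xw fw; have [_ ->] := word_chain xw fv.
  by move/(inj_map label_of_inj) ->.
Qed.

Definition letter_nlt l m := ~~ letter_lt l m.

(** Provides [unique_ext] with ascent-free prefixes and increasing extensions. *)
Lemma wpart_unique_ext u x : u \in words -> sorted letter_nlt u -> x \in wpart_set n ->
  wle (merges (wbot n) u) x ->
  exists! v, [/\ u ++ v \in words, merges (wbot n) (u ++ v) = x & sorted letter_lt v].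
Proof.
rewrite mem_words inE => fu _ xw le_x.
have [v [[fv ev sv] uv]] := increasing_word_exists_unique (merges_wpart wbot_wpart fu) le_x.
exists v; split=> [|t]; rewrite mem_words mergeable_word_cat merges_cat fu //= =>
  -[ft et st].
exact: uv.
Qed.

(** * Saturated chains as sets *)

Definition chain w := wbot n :: scanl merge_at (wbot n) w.
Definition chainset w : {set wpT n} := [set x in chain w].

Local Notation valid := (mergeable_word (wbot n)).
Local Notation top := (merges (wbot n)).
Local Notation is_chain := (is_schain (wpart_set n) (@wle n) (wbot n)).
Local Notation qmove := (qstep (wpart_set n) (@wle n) lab_lt (@lamE n)).
Local Notation qadj := (qrel (wpart_set n) (@wle n) lab_lt (@lamE n) (wbot n)).

Lemma top_wpart w : valid w -> is_wpart (top w).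
Proof. exact: (merges_wpart wbot_wpart). Qed.

Lemma nblocks_top w : valid w -> nblocks (top w) + size w = n.
Proof. by move=> fw; rewrite -(nblocks_merges wbot_wpart fw) nblocks_wbot. Qed.

Lemma chain_catl v w : chain (v ++ w) = chain v ++ scanl merge_at (top v) w.
Proof. by rewrite /chain /= scanl_cat. Qed.

Lemma mem_chainset w x : reflect (exists v t, w = v ++ t /\ x = top v) (x \in chainset w).
Proof.
rewrite in_set; apply: (iffP idP) => [|[v [t [-> ->]]]]; last first.
  by rewrite chain_catl mem_cat /chain -last_scanl mem_last.
elim/last_ind: w => [|w l IH]; first by rewrite inE => /eqP ->; exists [::], [::].
rewrite -cats1 chain_catl mem_cat => /orP[/IH[v [t [-> ->]]]|].
  by exists v, (t ++ [:: l]); rewrite catA.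
by rewrite inE => /eqP ->; exists (w ++ [:: l]), [::]; rewrite cats0 merges_cat.
Qed.

Lemma chain_uniq w : valid w -> uniq (chain w).
Proof.
elim/last_ind: w => [|w l IH] //; rewrite -cats1 chain_catl cat_uniq => fw.
have := fw; rewrite mergeable_word_cat => /andP[fw1 _]; rewrite IH //= orbF andbT.
apply/negP => h; have /mem_chainset[v [t [ew e]]] : merge_at (top w) l \in chainset w by rewrite inE.
have fv : valid v by move: fw1; rewrite ew mergeable_word_cat => /andP[].
have := nblocks_top fw;
  rewrite merges_cat -[merges (top w) _]/(merge_at (top w) l) e size_cat /=.
by have := nblocks_top fv; rewrite ew size_cat; lia.
Qed.

Lemma is_chainP C : reflect (exists2 w, valid w & C = chainset w) (is_chain C).
Proof.
have csE s : wbot n |: [set x in s] = [set x in wbot n :: s].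
  by apply/setP => x; rewrite !inE.
apply: (iffP existsP) => [[t /andP[p /eqP ->]]|[w fw ->]].
  have [w fw e] := chain_word wbot_wpart p.
  by exists w => //; rewrite csE e.
have sz : #|chainset w| = (size w).+1.
  by rewrite cardsE (card_uniqP (chain_uniq fw)) /= size_scanl.
have st : size (scanl merge_at (wbot n) w) == #|chainset w|.-1 by rewrite sz size_scanl.
exists (Tuple st); have [p _] := word_chain wbot_wpart fw.
by rewrite /= csE eqxx andbT.
Qed.

(** A chain has one element in each rank up to its length, so inclusion forces agreement rank by
    rank, and [merge_at_inj] recovers the letters. *)
Lemma chainset_sub u w : valid u -> valid w -> (chainset u \subset chainset w) =
  prefix u w.
Proof.
move=> fu fw; apply/idP/prefixP => [|[t ->]]; last first.
  by apply/subsetP => x; rewrite !in_set chain_catl mem_cat => ->.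
elim/last_ind: u fu => [|u l IH] ful sub; first by exists w.
have [fu _] : valid u /\ mergeable (top u) l.
  by move: ful; rewrite -cats1 mergeable_word_cat /= => /and3P[].
have [|t et] := IH fu.
  apply: subset_trans sub; apply/subsetP => x; rewrite !in_set -cats1 chain_catl mem_cat.
  by move=> ->.
have : top (rcons u l) \in chainset w.
  apply: (subsetP sub); apply/mem_chainset; exists (rcons u l), [::].
  by rewrite cats0.
case/mem_chainset => v [s [es e]].
have fv : valid v by move: fw; rewrite es mergeable_word_cat => /andP[].
have sv : size v = (size u).+1.
  have := nblocks_top ful; rewrite e size_rcons.
  by have := nblocks_top fv; lia.
have ev : v = take (size u).+1 w by rewrite es -sv take_size_cat.
case: t et => [|m t] et.
  by have := congr1 size ev; rewrite sv et cats0 take_oversize //; lia.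
have vE : v = rcons u m by rewrite ev et -cat_rcons -(size_rcons u m) take_size_cat.
have fum : mergeable (top u) m.
  by move: fv; rewrite vE -cats1 mergeable_word_cat /= => /and3P[].
have ful' : mergeable (top u) l.
  by move: ful; rewrite -cats1 mergeable_word_cat /= => /and3P[].
move: e; rewrite vE -!cats1 !merges_cat /= => /(merge_at_inj (top_wpart fu) ful' fum) ->.
by exists t; rewrite et -catA.
Qed.

Lemma chainset_inj u w : valid u -> valid w -> chainset u = chainset w -> u = w.
Proof.
move=> fu fw e; have : chainset u \subset chainset w by rewrite e.
have : chainset w \subset chainset u by rewrite e.
rewrite !chainset_sub // => /prefixP[t ->] /prefixP[s].
rewrite -catA -[LHS]cats0 => /(congr1 size); rewrite !size_cat => h.
have t0 : t = [::] by apply: size0nil; move: h; rewrite /=; lia.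
by rewrite t0 cats0.
Qed.

Lemma mergeable_word_swap x p l m s : is_wpart x -> mergeable_word x (p ++ [:: l, m &
  s]) -> letter_lt l m ->
  mergeable_word x (p ++ [:: m, l & s]) /\
  forall s', merges x (p ++ [:: m, l & s']) = merges x (p ++ [:: l, m & s']).
Proof.
move=> xw; rewrite !mergeable_word_cat /= => /and4P[fp fl fm fs] lm.
have pw := merges_wpart xw fp.
have nlm : l.1.1 != m.1.2.
  by apply: (letter_lt_neq _ lm); have := fm; rewrite mergeable_merge_at // =>
    /and3P[fxm _ _]; exact: fxm.
have [f1 f2 e] := merge_at_swap pw fl fm nlm.
by rewrite fp f1 f2 e fs; split=> // s'; rewrite !merges_cat /merges /= e.
Qed.

(** Only the element one letter after [p] changes; distinctness of chain elements ensures that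
    nothing else is removed. *)
Lemma chainset_swap p l m s : valid (p ++ [:: l, m & s]) -> letter_lt l m ->
  chainset (p ++ [:: m, l & s]) =
  merge_at (top p) m |: (chainset (p ++ [:: l, m & s]) :\ merge_at (top p) l).
Proof.
move=> fw lm; have [fw' e] := mergeable_word_swap wbot_wpart fw lm.
have := e [::]; rewrite !merges_cat /= => e2; rewrite /merges /= -/(merges _ _) in e2.
have mc v y : (y \in chainset v) = (y \in chain v) by rewrite in_set.
have sc y k t : scanl merge_at y (k :: t) =
  merge_at y k :: scanl merge_at (merge_at y k) t by [].
have := chain_uniq fw; rewrite chain_catl cat_uniq !sc cons_uniq.
case/and3P => _ /hasPn h /andP[b2 _].
have b1 : merge_at (top p) l \notin chain p by apply: h; apply: mem_head.
apply/setP => x; rewrite in_setU1 in_setD1 !mc !chain_catl !mem_cat !sc !in_cons e2.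
case: (eqVneq x (merge_at (top p) m)) => [_|_]; first by rewrite !orbT.
case: (eqVneq x (merge_at (top p) l)) => [->|_] //.
move: b2; rewrite in_cons negb_or => /andP[b2 b3].
move: b1; rewrite in_cons negb_or => /andP[b0 b1].
by rewrite (negbTE b0) (negbTE b1) (negbTE b2) (negbTE b3).
Qed.

(** * Quadratic exchanges on words and their trace invariants *)

Definition exchange w w' := exists p l m s,
  [/\ letter_lt l m, w = p ++ [:: l, m & s] & w' = p ++ [:: m, l & s]].

(** By rank, a chain element covering [top p] can only be the next one. *)
Lemma chain_next w p t b : valid w -> w = p ++ t -> b \in chainset w -> cov (top p) b ->
  exists l s, t = l :: s /\ b = merge_at (top p) l.
Proof.
move=> fw ew /mem_chainset[q [r [ew' ->]]] /covP[pw [k fk e]].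
have fp : valid p by move: fw; rewrite ew mergeable_word_cat => /andP[].
have fq : valid q by move: fw; rewrite ew' mergeable_word_cat => /andP[].
have sq : size q = (size p).+1.
  have := nblocks_top fq; rewrite e; have := nblocks_top fp;
    rewrite (nblocks_merge_at pw fk); lia.
have eq_q : q = take (size p).+1 (p ++ t) by rewrite -ew ew' -sq take_size_cat.
case: t ew eq_q => [|l t] ew eq_q.
  by have := congr1 size eq_q; rewrite sq cats0 take_oversize //; lia.
exists l, t; split=> //; rewrite eq_q -cat_rcons -(size_rcons p l) take_size_cat //.
by rewrite -cats1 merges_cat.
Qed.

(** By [chain_next] the three elements named in [qstep] are consecutive in the chain, and the
    prescribed labels identify the new element. *)
Lemma qmove_exchange w D : valid w -> qmove (chainset w) D ->
  exists2 w', valid w' & D = chainset w' /\ exchange w w'.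
Proof.
move=> fw /existsP[a /andP[aC /existsP[b /andP[bC /existsP[c /andP[cC /existsP[b' H]]]]]]].
have /mem_chainset[p [t [ew ea]]] := aC; rewrite ea in H.
case/and5P: H => cab cbc lt cab' /and4P[cbc' /eqP e1 /eqP e2 /eqP ->].
have [l [t' [et eb]]] := chain_next fw ew bC cab.
have eb' : b = top (rcons p l) by rewrite -cats1 merges_cat.
rewrite eb' in cbc.
have [m [s [et' ec]]] := chain_next fw (etrans ew (etrans (congr1 (cat p) et) (esym (cat_rcons _ _ _)))) cC cbc.
have {}ew : w = p ++ [:: l, m & s] by rewrite ew et et'.
have := fw; rewrite ew mergeable_word_cat /= => /and4P[fp fl fm _].
have pw := top_wpart fp; have lw := merge_at_wpart pw fl.
have /covP[_ [k fk eb'']] := cab'.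
have eC : c = merge_at b m by rewrite eb' ec.
move: lt e1; rewrite eC eb !lamE_merge_at // => lm; rewrite eb'' lamE_merge_at // =>
  /label_of_inj ->.
have fw' := fw; rewrite ew in fw'.
exists (p ++ [:: m, l & s]); first by have [] := mergeable_word_swap wbot_wpart fw' lm.
split; last by exists p, l, m, s.
by rewrite (chainset_swap fw' lm).
Qed.

Lemma exchange_qmove w w' : valid w -> exchange w w' -> qmove (chainset w) (chainset w').
Proof.
move=> fw [p [l [m [s [lm ew ->]]]]]; subst w.
have := fw; rewrite mergeable_word_cat /= => /and4P[fp fl fm _].
have pw := top_wpart fp; have lw := merge_at_wpart pw fl.
have nlm : l.1.1 != m.1.2.
  by apply: (letter_lt_neq _ lm); have := fm; rewrite mergeable_merge_at // =>
    /and3P[fxm _ _]; exact: fxm.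
have [f1 f2 e] := merge_at_swap pw fl fm nlm.
have cov_st y k : is_wpart y -> mergeable y k -> cov y (merge_at y k).
  by move=> yw fk; apply/covP; split=> //; exists k.
have mem v t : p ++ [:: l, m & s] = v ++ t -> top v \in chainset (p ++ [:: l, m & s]).
  by move=> E; apply/mem_chainset; exists v, t.
apply/existsP; exists (top p); rewrite (mem p [:: l, m & s]) //=.
apply/existsP; exists (merge_at (top p) l).
have := mem (p ++ [:: l]) (m :: s); rewrite -catA merges_cat => /(_ erefl) -> /=.
apply/existsP; exists (merge_at (merge_at (top p) l) m).
have := mem (p ++ [:: l; m]) s; rewrite -catA merges_cat => /(_ erefl) -> /=.
apply/existsP; exists (merge_at (top p) m).
have mw := merge_at_wpart pw f1.
have c1 : cov (merge_at (top p) m) (merge_at (merge_at (top p) l) m) by rewrite -e cov_st.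
have l1 : lamE (merge_at (top p) m) (merge_at (merge_at (top p) l) m) =
  label_of l by rewrite -e lamE_merge_at.
rewrite (cov_st _ _ pw fl) (cov_st _ _ lw fm) (cov_st _ _ pw f1) c1 l1.
rewrite (lamE_merge_at pw fl) (lamE_merge_at lw fm) (lamE_merge_at pw f1) (chainset_swap fw lm).
rewrite !eqxx !andbT.
exact: lm.
Qed.

(* As in trace theory, a word up to exchanges is recorded by its projections to the
   pairs of incomparable letters. *)
Definition letters_comparable l m := letter_lt l m || letter_lt m l.
Definition same_traces w v := forall l m, ~~ letters_comparable l m ->
  [seq k <- w | (k == l) || (k == m)] = [seq k <- v | (k == l) || (k == m)].

Lemma same_traces_perm w v : same_traces w v -> perm_eq w v.
Proof.
move=> wv; apply/allP => l _ /=; have := wv l l.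
rewrite /letters_comparable letter_lt_irr => /(_ isT) /(congr1 size).
rewrite !size_filter => e; apply/eqP; move: e.
by rewrite !(@eq_count _ (fun k => (k == l) || (k == l)) (pred1 l)) // => k;
  rewrite /= orbb.
Qed.

Lemma same_traces_sym w v : same_traces w v -> same_traces v w.
Proof. by move=> h l m /h. Qed.

Lemma same_traces_trans u w v : same_traces u w -> same_traces w v -> same_traces u v.
Proof. by move=> h1 h2 l m lm; rewrite h1 ?h2. Qed.

Lemma same_traces_catK u w v : same_traces (u ++ w) (u ++ v) -> same_traces w v.
Proof.
move=> h l m /h; rewrite !filter_cat => /eqP.
by rewrite eqseq_cat // eqxx => /eqP.
Qed.

(** Exchanged letters are comparable and distinct, so no projection to an incomparable pair sees
    both. *)
Lemma exchange_same_traces w v : exchange w v -> same_traces w v.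
Proof.
move=> [p [l [m [s [lm -> ->]]]]] a b; rewrite /letters_comparable negb_or =>
  /andP[nab nba].
rewrite !filter_cat /=; congr (_ ++ _).
case: (eqVneq l a) => [la|_]; case: (eqVneq m a) => [ma|_] //=.
- by rewrite la ma letter_lt_irr in lm.
- case: (eqVneq m b) => [mb|//]; first by rewrite -la -mb lm in nab.
- case: (eqVneq l b) => [lb|//]; first by rewrite -lb -ma lm in nba.
case: (eqVneq l b) => [lb|//]; case: (eqVneq m b) => [mb|//].
by rewrite lb mb letter_lt_irr in lm.
Qed.

(** If the next letter [p] is below [m], continue from [p]; if it is above, then [l < m < p] gives
    an ascent at once. *)
Lemma ascent_before l q m s : letter_lt l m -> (forall p, p \in q ->
  letters_comparable p m) ->
  ~~ sorted letter_nlt (l :: q ++ m :: s).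
Proof.
elim: q l => [|p q IH] l lm cq /=; first by rewrite /letter_nlt lm.
apply/nandP; have /orP[pm|mp] := cq p (mem_head _ _); [right|left].
  by apply: (IH p) => // r rq; apply: cq; rewrite inE rq orbT.
by rewrite negbK (letter_lt_trans lm mp).
Qed.

(** A letter before the first [m] and incomparable to it would lead the projection to that pair,
    whereas [m] leads it in the other word. *)
Lemma same_traces_head l w m v : same_traces (l :: w) (m :: v) -> l != m ->
  letters_comparable l m /\ exists q s, w = q ++ m :: s /\ forall p, p \in q ->
    letters_comparable p m.
Proof.
move=> h lm; split.
  apply/negPn/negP => /h /=; rewrite !eqxx !orbT => -[e].
  by rewrite e eqxx in lm.
have mw : m \in w.
  have := perm_mem (same_traces_perm h) m.
  by rewrite !inE eqxx [m == l]eq_sym (negbTE lm) /= => ->.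
have [q [s [ew mq]]] : exists q s, w = q ++ m :: s /\ m \notin q.
  exists (take (index m w) w), (drop (index m w).+1 w); split.
    by rewrite -[m in m :: _](nth_index l mw) -drop_nth ?index_mem // cat_take_drop.
  by rewrite in_take // ltnn.
exists q, s; split=> // p pq; apply/negPn/negP => /h.
rewrite ew /= eqxx orbT filter_cat.
case: (boolP ((l == p) || (l == m))) => [/orP[/eqP lp|/eqP e]|_].
- by move=> [e]; rewrite e eqxx in lm.
- by move=> [e']; rewrite e' eqxx in lm.
have : p \in [seq k <- q | (k == p) || (k == m)] by rewrite mem_filter eqxx.
case e: [seq k <- q | _] => [//|a f] _ [am].
have : a \in [seq k <- q | (k == p) || (k == m)] by rewrite e mem_head.
by rewrite mem_filter am (negbTE mq) andbF.
Qed.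

(** If the heads differ they are comparable; in the word starting with the smaller one,
    [ascent_before] finds an ascent up to the larger one. *)
Lemma ascent_free_unique w v : sorted letter_nlt w -> sorted letter_nlt v ->
  same_traces w v -> w = v.
Proof.
elim: w v => [|l w IH] [|m v] sw sv h.
- by [].
- by have /perm_size := same_traces_perm h.
- by have /perm_size := same_traces_perm h.
have [e|ne] := eqVneq l m.
  subst m; congr (_ :: _); apply: IH; [exact: path_sorted sw|exact: path_sorted sv|].
  exact: (@same_traces_catK [:: l]).
have [/orP[lm|ml] [q [s [ew cq]]]] := same_traces_head h ne.
  by have := ascent_before s lm cq; rewrite -ew sw.
rewrite eq_sym in ne.
have [_ [q' [s' [ev cq']]]] := same_traces_head (same_traces_sym h) ne.
by have := ascent_before s' ml cq'; rewrite -ev sv.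
Qed.

(** * Exchange classes of words *)

Lemma qadj_sym : symmetric qadj.
Proof. by move=> C D; rewrite /qrel andbCA [qmove D C || _]orbC. Qed.

Lemma qadj_words w D : valid w -> qadj (chainset w) D ->
  exists2 v, valid v & D = chainset v /\ (exchange w v \/ exchange v w).
Proof.
move=> fw /and3P[_ /is_chainP[v fv ->] /orP[|] q].
  have [v' fv' [/(chainset_inj fv fv') -> e]] := qmove_exchange fw q.
  by exists v' => //; split=> //; left.
have [w' fw' [/(chainset_inj fw fw') -> e]] := qmove_exchange fv q.
by exists v => //; split=> //; right.
Qed.

Lemma exchange_qadj w v : valid w -> valid v -> exchange w v ->
  qadj (chainset w) (chainset v).
Proof.
move=> fw fv e; apply/and3P; split; [apply/is_chainP|apply/is_chainP|].
- by exists w.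
- by exists v.
by rewrite exchange_qmove.
Qed.

Lemma exchange_catr w v t : exchange w v -> exchange (w ++ t) (v ++ t).
Proof.
by move=> [p [l [m [s [lm -> ->]]]]]; exists p, l, m, (s ++ t); rewrite -!catA.
Qed.

Lemma exchange_top w v : valid w -> exchange w v -> top v = top w.
Proof.
by move=> fw [p [l [m [s [lm ew ->]]]]]; subst w;
  have [_ ->] := mergeable_word_swap wbot_wpart fw lm.
Qed.

Definition equivalent w v := connect qadj (chainset w) (chainset v).

(** Endpoint and traces are invariant, and the exchanges can be replayed in front of any [t], which
    stays valid as the endpoint is unchanged. *)
Lemma connect_words w D : valid w -> connect qadj (chainset w) D ->
  exists2 v, valid v & [/\ D = chainset v, top v = top w, same_traces w v &
    forall t, valid (w ++ t) -> equivalent (w ++ t) (v ++ t)].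
Proof.
move=> fw /connectP[s]; elim: s w fw => [|C s IH] w fw /=.
  by move=> _ ->; exists w => //; split=> // t _; apply: connect0.
case/andP=> /(qadj_words fw) [u fu [-> e]] p /(IH u fu p) [v fv [-> tv uv ev]].
have tu : top u = top w.
  by case: e => e; [exact: exchange_top|exact/esym/exchange_top].
exists v => //; split=> //; first by rewrite tv.
  apply: same_traces_trans uv; case: e => /exchange_same_traces //.
  exact: same_traces_sym.
move=> t fwt; have fut : valid (u ++ t).
  by move: fwt; rewrite !mergeable_word_cat fu fw tu.
apply: connect_trans (ev _ fut); apply: connect1.
case: e => /(exchange_catr t); first exact: exchange_qadj.
by rewrite qadj_sym; apply: exchange_qadj.
Qed.

Lemma equivalentP w v : valid w -> valid v -> equivalent w v ->
  [/\ top v = top w, same_traces w v &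
    forall t, valid (w ++ t) -> equivalent (w ++ t) (v ++ t)].
Proof.
move=> fw fv /(connect_words fw) [v' fv' [/(chainset_inj fv fv') -> tv wv ev]].
by split.
Qed.

(** Counts ascending pairs in any positions, not only adjacent ones, so that reversing an adjacent
    ascent always lowers it. *)
Fixpoint ascents w : nat := if w is l :: w' then count (letter_lt l) w' + ascents w' else 0.

Lemma ascents_swap p l m s : letter_lt l m ->
  ascents (p ++ [:: m, l & s]) < ascents (p ++ [:: l, m & s]).
Proof.
move=> lm; elim: p => [|k p IH] /=.
  by rewrite lm (negbTE (letter_lt_asym lm)); lia.
rewrite -addnS leq_add // !count_cat /= leq_add2l; lia.
Qed.

Lemma ascent_split w : ~~ sorted letter_nlt w ->
  exists p l m s, w = p ++ [:: l, m & s] /\ letter_lt l m.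
Proof.
elim: w => [|l [|m w] IH] //=; rewrite negb_and => /orP[|/IH [p [a [b [s [-> ab]]]]]].
  by rewrite negbK => lm; exists [::], l, m, w.
by exists (l :: p), a, b, s.
Qed.

(** Reverse adjacent ascents inside [v] only; [ascents] decreases. *)
Lemma ascent_free_exists u v : valid (u ++ v) -> exists t,
  [/\ valid (u ++ t), equivalent (u ++ v) (u ++ t) & sorted letter_nlt t].
Proof.
have [k] := ubnP (ascents v); elim: k v => // k IH v lt_k fuv.
have [sv|/ascent_split[p [l [m [s [ev lm]]]]]] := boolP (sorted letter_nlt v).
  by exists v; split=> //; apply: connect0.
subst v; have fv := fuv; rewrite catA in fv.
have [fv' _] := mergeable_word_swap wbot_wpart fv lm; rewrite -catA in fv'.
have [|//|t [ft et st]] := IH (p ++ [:: m, l & s]).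
  by have := ascents_swap p s lm; lia.
exists t; split; [exact: ft| |exact: st].
apply: connect_trans et; apply: connect1; apply: (exchange_qadj fuv fv').
by exists (u ++ p), l, m, s; rewrite -!catA.
Qed.

(** * The poset of classes and Whitney duality *)

Definition word_class w := qclass (wpart_set n) (@wle n) lab_lt (@lamE n) (wbot n) (chainset w).

Lemma word_class_eq w v : word_class w = word_class v <-> equivalent w v.
Proof.
split=> [e|wv]; last first.
  apply/setP => D; rewrite !inE.
  exact: (same_connect (sym_connect_sym qadj_sym) wv).
have : chainset v \in word_class v by rewrite inE connect0.
by rewrite -e inE.
Qed.

Lemma equivalent_sym w v : equivalent w v -> equivalent v w.
Proof. by rewrite /equivalent (sym_connect_sym qadj_sym). Qed.

Local Notation Qset := (Q_carrier (wpart_set n) (@wle n) lab_lt (@lamE n) (wbot n)).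
Local Notation Qle := (Q_le (wpart_set n) (@wle n) lab_lt (@lamE n) (wbot n)).

Lemma Q_carrierP X : reflect (exists2 w, valid w & X = word_class w) (X \in Qset).
Proof.
apply: (iffP imsetP) => [[C]|[w fw ->]].
  by rewrite inE => /is_chainP[w fw ->] ->; exists w.
by exists (chainset w) => //; rewrite inE; apply/is_chainP; exists w.
Qed.

Lemma word_class_cat_sub c u t : valid c -> valid u -> equivalent u c -> valid (c ++ t) ->
  valid (u ++ t) /\ word_class (u ++ t) = word_class (c ++ t).
Proof.
move=> fc fu uc fct.
have [tu _ ect] := equivalentP fc fu (equivalent_sym uc).
split; first by move: fct; rewrite !mergeable_word_cat fc fu tu.
exact/word_class_eq/equivalent_sym/ect.
Qed.

(** Each step compares classes through some pair of representatives; [word_class_cat_sub] transfers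
    the extension to the word at hand, so a whole path becomes one extension of [u]. *)
Lemma Q_leP u X : valid u -> Qle (word_class u) X <-> exists2 v, valid (u ++ v) &
  word_class (u ++ v) = X.
Proof.
move=> fu; split=> [/connectP[s]|[v fuv <-]]; last first.
  apply: connect1; apply/and3P; split; [apply/Q_carrierP|apply/Q_carrierP|].
  - by exists u.
  - by exists (u ++ v).
  apply/existsP; exists (chainset u); rewrite inE connect0 /=.
  apply/existsP; exists (chainset (u ++ v)); rewrite inE connect0 /=.
  by rewrite chainset_sub // prefix_prefix.
elim: s u fu => [|Y s IH] u fu /=.
  by move=> _ ->; exists [::]; rewrite cats0.
case/andP=> /and3P[_ /Q_carrierP[y fy ->] /existsP[C /andP[Cu /existsP[D /andP[Dy CD]]]]].
rewrite inE in Cu; have [c fc [eC _ _ _]] := connect_words fu Cu.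
rewrite inE in Dy; have [d fd [eD _ _ _]] := connect_words fy Dy.
move=> p eX; rewrite eC eD chainset_sub // in CD.
have [t ed] := prefixP CD.
have uc : equivalent u c by rewrite /equivalent -eC.
rewrite ed in fd; have [fut eut] := word_class_cat_sub fc fu uc fd.
have ey : word_class y = word_class (u ++ t).
  by rewrite eut -ed; apply/word_class_eq; rewrite /equivalent -eD.
rewrite ey in p eX; have [v fv ev] := IH _ fut p eX.
by exists (t ++ v); rewrite catA.
Qed.

Lemma Q_model : word_model Qset Qle words word_class.
Proof.
split=> [|//|X|u v|u X|u w].
- exact: words_uniq.
- by rewrite mem_words.
- split=> [/Q_carrierP[w fw ->]|[w]]; first by exists w; rewrite ?mem_words.
  by rewrite mem_words => fw <-; apply/Q_carrierP; exists w.
- by rewrite !mem_words mergeable_word_cat => /andP[].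
- rewrite mem_words => fu _; apply: (iff_trans (Q_leP _ fu)).
  by split=> -[v fv ev]; exists v => //; move: fv; rewrite mem_words.
- rewrite !mem_words =>
  fu fw /word_class_eq /(equivalentP fu fw) [_ /same_traces_perm uw _].
  exact: perm_size.
Qed.

(** For uniqueness, the prefix [u] cancels from the traces and leaves two ascent-free words with
    equal traces. *)
Lemma Q_unique_ext u X : u \in words -> sorted letter_lt u -> X \in Qset ->
  Qle (word_class u) X ->
  exists! v, [/\ u ++ v \in words, word_class (u ++ v) = X & sorted letter_nlt v].
Proof.
rewrite mem_words => fu _ _ /(Q_leP _ fu)[v fuv <-].
have [t [fut et st]] := ascent_free_exists fuv.
exists t; split=> [|s []]; rewrite mem_words.
  by split; [exact: fut|exact/word_class_eq/equivalent_sym/et|exact: st].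
move=> fus /word_class_eq es ss; apply: (ascent_free_unique st ss).
have [_ h _] := equivalentP fuv fut et; have [_ h' _] := equivalentP fus fuv es.
apply: (@same_traces_catK u); apply: same_traces_sym.
exact: same_traces_trans h' h.
Qed.

Lemma Q_bot_word_class : Q_bot (wpart_set n) (@wle n) lab_lt (@lamE n) (wbot n) =
  word_class [::].
Proof. by congr qclass; apply/setP => x; rewrite !inE. Qed.

(** The two models share their words and interchange the roles of increasing and ascent-free, so
    both sides of each equation count the same words of length [k]. *)
Lemma wpart_whitney_dual :
  whitney_dual (wpart_set n) (@wle n) (wbot n) Qset Qle
    (Q_bot (wpart_set n) (@wle n) lab_lt (@lamE n) (wbot n)).
Proof.
have nltE l m : letter_nlt l m = ~~ letter_lt l m by [].
have ltN l m : letter_lt l m = ~~ letter_nlt l m by rewrite negbK.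
rewrite Q_bot_word_class; split; [exact: wm_ranked wpart_model|exact: wm_ranked Q_model|].
move=> k; split.
  rewrite (wm_whitney1 wpart_model ltN wpart_unique_ext).
  by rewrite (wm_whitney2 Q_model Q_unique_ext).
rewrite (wm_whitney1 Q_model nltE Q_unique_ext).
by rewrite (wm_whitney2 wpart_model wpart_unique_ext).
Qed.

End WeightedPartitions.

Theorem theorem5p21 (n : nat) : 0 < n ->
  EW_labeling (wpart_set n) (@wle n) lab_lt (@lamE n) (wbot n) /\
  whitney_dual (wpart_set n) (@wle n) (wbot n)
    (Q_carrier (wpart_set n) (@wle n) lab_lt (@lamE n) (wbot n))
    (Q_le (wpart_set n) (@wle n) lab_lt (@lamE n) (wbot n))
    (Q_bot (wpart_set n) (@wle n) lab_lt (@lamE n) (wbot n)).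
Proof. by move=> _; split; [exact: lamE_EW|exact: wpart_whitney_dual]. Qed.
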